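(* For any given $(\rho,\alpha)\in\big([0,1]\setminus\mathbb{Q}\big)\times(0,1)$ there exists a $C^\infty$ bi-critical circle map with rotation number $\rho$, with a unique invariant Borel probability measure $\mu$, and with exactly two critical points $c_1$ and $c_2$, such that the two connected components of $S^1\setminus\{c_1,c_2\}$ have $\mu$-measures equal to $\alpha$ and $1-\alpha$ respectively.
   Context: A critical point $c$ of a one-dimensional $C^3$ map $f$ is non-flat of criticality $d>1$ if there is a neighbourhood $W$ of $c$ such that $f(x)=f(c)+\phi(x)|\phi(x)|^{d-1}$ for all $x\in W$, where $\phi:W\to\phi(W)$ is a $C^3$ diffeomorphism with $\phi(c)=0$. A multicritical circle map is an orientation-preserving $C^3$ homeomorphism of $S^1=\mathbb{R}/\mathbb{Z}$ having $N\ge1$ critical points, all of which are non-flat; it is bi-critical if $N=2$. *)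

(* Defs.v *)
From HB Require Import structures.
From mathcomp Require Import all_boot all_order all_algebra.
From mathcomp Require Import all_classical all_reals all_analysis.
Import Order.TTheory GRing.Theory Num.Theory.
Import numFieldTopology.Exports numFieldNormedType.Exports.

Set Implicit Arguments.
Unset Strict Implicit.
Unset Printing Implicit Defensive.

Local Open Scope classical_set_scope.
Local Open Scope ring_scope.
Local Open Scope quotient_scope.
Local Open Scope card_scope.

Definition congr_mod1 {R : realType} (x y : R) : bool := x - y \is a Num.int.

Lemma congr_mod1_equiv (R : realType) : equiv_class_of (@congr_mod1 R).
Proof.
split=> [x|x y|y x z]; rewrite /congr_mod1 ?subrr ?rpred0 //.
  by rewrite -opprB rpredN.
by move=> xy yz; rewrite -[x](subrK y) -addrA rpredD.
Qed.

Canonical congr_mod1_equivRel (R : realType) :=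
  EquivRelPack (@congr_mod1_equiv R).
Canonical congr_mod1_encModRel (R : realType) :=
  defaultEncModRel (@congr_mod1 R).

Definition circle (R : realType) : Type :=
  quotient_topology {eq_quot (@congr_mod1 R)}.

HB.instance Definition _ (R : realType) := PointedTopological.on (circle R).

Definition circle_pi {R : realType} (x : R) : circle R :=
  \pi_({eq_quot (@congr_mod1 R)}) x.

Definition circle_borel (R : realType) :=
  g_sigma_algebraType (@open (circle R)).

Definition components {T : topologicalType} (U : set T) : set (set T) :=
  [set connected_component U x | x in U].

Definition Ck_on {R : realType} (k : nat) (U : set R) (g : R -> R) : Prop :=
  (forall j x, (j < k)%N -> U x -> derivable (derive1n j g) x 1) /\
  (forall x, U x -> {for x, continuous (derive1n k g)}).

Definition Ck_diffeo_on {R : realType} (k : nat) (W : set R) (phi : R -> R)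
    : Prop :=
  [/\ open W, open (phi @` W), Ck_on k W phi
    & exists psi : R -> R,
        Ck_on k (phi @` W) psi /\ (forall x, W x -> psi (phi x) = x)].

Definition nonflat_at {R : realType} (g : R -> R) (c d : R) : Prop :=
  exists (W : set R) (phi : R -> R),
    [/\ W c, Ck_diffeo_on 3 W phi, phi c = 0
      & forall x, W x -> g x = g c + phi x * `|phi x| `^ (d - 1)].

(* Local notions for circle maps (smoothness, derivatives, normal forms at
   critical points) are read off a lift to R. Two lifts of the same map differ
   by an integer constant, so the choice of the lift is immaterial. *)
Definition is_lift {R : realType} (f : circle R -> circle R) (F : R -> R)
    : Prop :=
  continuous F /\ forall x, circle_pi (F x) = f (circle_pi x).

Definition circle_Ck {R : realType} (k : nat) (f : circle R -> circle R)
    : Prop :=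
  exists F, is_lift f F /\ Ck_on k setT F.

Definition circle_smooth {R : realType} (f : circle R -> circle R) : Prop :=
  forall k, circle_Ck k f.

Definition homeomorphism {T : topologicalType} (f : T -> T) : Prop :=
  continuous f /\
  exists g : T -> T, [/\ continuous g, cancel f g & cancel g f].

Definition orientation_preserving {R : realType} (f : circle R -> circle R)
    : Prop :=
  exists F, is_lift f F /\ {homo F : x y / x < y}.

Definition critical_point {R : realType} (f : circle R -> circle R)
    (c : circle R) : Prop :=
  exists F x, [/\ is_lift f F, circle_pi x = c & is_derive x 1 F 0].

Definition nonflat {R : realType} (f : circle R -> circle R) (c : circle R)
    : Prop :=
  exists F x d, [/\ is_lift f F, circle_pi x = c, 1 < d & nonflat_at F x d].

Definition multicritical {R : realType} (N : nat) (f : circle R -> circle R)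
    : Prop :=
  [/\ (0 < N)%N, circle_Ck 3 f, homeomorphism f /\ orientation_preserving f,
      critical_point f #= `I_N
    & forall c, critical_point f c -> nonflat f c].

(* The rotation number is the class mod 1 of lim (F^n(x) - x) / n, for any
   lift F and any x. Changing F by an integer shifts the limit by that integer,
   hence rho represents this class iff it is the limit for some lift. *)
Definition has_rotation_number {R : realType} (f : circle R -> circle R)
    (rho : R) : Prop :=
  exists F, is_lift f F /\
    forall x, (fun n : nat => (iter n F x - x) / n%:R) @ \oo --> rho.

Definition invariant {R : realType} (f : circle R -> circle R)
    (mu : probability (circle_borel R) R) : Prop :=
  forall A : set (circle_borel R), measurable A -> mu (f @^-1` A) = mu A.

(* Measures are compared on Borel sets only: as functions on all subsets they
   carry junk values outside the sigma-algebra. *)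
Definition unique_invariant {R : realType} (f : circle R -> circle R)
    (mu : probability (circle_borel R) R) : Prop :=
  invariant f mu /\
  forall nu : probability (circle_borel R) R, invariant f nu ->
    forall A : set (circle_borel R), measurable A -> nu A = mu A.

(* Main.v *)
Require Import Defs.
From HB Require Import structures.
From mathcomp Require Import all_boot all_order all_algebra.
From mathcomp Require Import all_classical all_reals all_analysis.
From mathcomp Require Import measurable_realfun ring lra.
Import Order.TTheory GRing.Theory Num.Theory.
Import numFieldTopology.Exports numFieldNormedType.Exports.

Local Open Scope classical_set_scope.
Local Open Scope ring_scope.

Set Implicit Arguments.
Unset Strict Implicit.
Unset Printing Implicit Defensive.

(** Consider the lifts [F_t(x) = x + w + (trigonometric polynomial)] whose
    derivative is a positive multiple of
    [(1 - cos 2 pi x) (1 - cos 2 pi (x - t))]: they have cubic critical points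
    exactly at [0] and [t] modulo 1. Choosing [w = w(t)] as the largest parameter
    for which the displacements of all iterates stay below [n rho + 1] gives
    rotation number [rho] and a continuous [w]. Then [F_t] is semiconjugate to
    the translation by [rho] through [h_t = limsup (F_t^n - n rho)], and
    [h_t(t) - h_t(0)] varies from 0 to 1 with [t]. Because the points
    [n rho + m] with [n >= 0] are dense, each of the conditions
    [h_t(t) - h_t(0) > alpha] and [< alpha] is witnessed by one point of the
    forward orbit of [0], hence is open in [t]; by connectedness the value
    [alpha] is attained. The image of Lebesgue measure under a quasi-inverse of
    [h_t] is invariant. It is the only invariant measure: the integral of
    [floor (x - u)] against any invariant measure in the variable [u] is a
    distribution function [N] with [N (F x) = N x + const], and such a
    semiconjugacy is unique up to an additive constant. *)

(** * Functions of class C^k on open sets *)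

(** The obstacle is the dependence on [t]: a limsup gives no continuity of [h_t] in [t]. Only finite
    orbit segments vary continuously, so [h_t] is always compared with orbit points, where it is
    known exactly up to its value at 0. The same comparison yields the continuity of each [h_t] and
    the uniqueness of semiconjugacies. The limsup is finite because the rotation number is available
    in a uniform form, [|F^n x - x - n rho| <= 1], which the choice of [w] delivers directly.
    Wandering intervals are not excluded, so [h_t] may be constant on intervals and a quasi-inverse
    stands in for its inverse. At [t = 0] and [t = 1] the two critical points merge, but the lift is
    still increasing of degree one; hence the family can be studied on the whole line. Non-flatness
    asks for a coordinate that is smooth at the critical point itself, where
    [(F (c + y) - F c) / y^3] has the form 0/0. Power series with factorially decaying coefficients
    can be divided by [y^3] exactly, and the quotient is again smooth. *)

Fixpoint Ck_rec {R : realType} (k : nat) (U : set R) (g : R -> R) : Prop :=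
  if k is k'.+1 then
    exists g', (forall x, U x -> is_derive x 1 g (g' x)) /\ Ck_rec k' U g'
  else forall x, U x -> {for x, continuous g}.

Lemma is_derive_continuous {R : realType} (f : R -> R) (x df : R) :
  is_derive x 1 f df -> {for x, continuous f}.
Proof. by move=> [d _]; exact/differentiable_continuous/derivable1_diffP. Qed.

Lemma is_derive_unique {R : realType} (f : R -> R) (x a b : R) :
  is_derive x 1 f a -> is_derive x 1 f b -> a = b.
Proof. by move=> [_ <-] [_ <-]. Qed.

Lemma is_derive_open_eq {R : realType} (U : set R) (f g : R -> R) (x df : R) :
  open U -> U x -> (forall y, U y -> f y = g y) ->
  is_derive x 1 f df -> is_derive x 1 g df.
Proof.
move=> oU Ux fg; apply: near_eq_is_derive.
by near=> y; rewrite fg//; near: y; exact: open_nbhs_nbhs.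
Unshelve. all: by end_near. Qed.

Section Ck_rec_theory.
Context {R : realType}.
Implicit Types (U V : set R) (f g : R -> R) (k : nat).

Lemma Ck_recW k U f : Ck_rec k.+1 U f -> Ck_rec k U f.
Proof.
elim: k f => [|k IH] f /= [f' [ff' ckf']].
  by move=> x Ux; exact: is_derive_continuous (ff' x Ux).
by exists f'; split => //; exact: IH.
Qed.

Lemma Ck_rec_sub k U V f : U `<=` V -> Ck_rec k V f -> Ck_rec k U f.
Proof.
move=> UV; elim: k f => [|k IH] f /=; first by move=> cf x /UV; exact: cf.
move=> [f' [ff' ckf']]; exists f'; split; last exact: IH.
by move=> x /UV; exact: ff'.
Qed.

Lemma Ck_rec_eq k U f g : open U -> (forall x, U x -> f x = g x) ->
  Ck_rec k U f -> Ck_rec k U g.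
Proof.
move=> oU fg; case: k => [|k] /=.
  move=> cf x Ux; rewrite /prop_for /continuous_at -fg//.
  apply: cvg_trans (cf x Ux); apply: near_eq_cvg.
  by apply: filterS (open_nbhs_nbhs (conj oU Ux)) => y Uy; rewrite fg.
move=> [f' [ff' ckf']]; exists f'; split => // x Ux.
exact: (is_derive_open_eq oU Ux fg (ff' x Ux)).
Qed.

Lemma Ck_rec_cst k U (c : R) : Ck_rec k U (fun=> c).
Proof.
elim: k c => [|k IH] c /=; first by move=> x _; exact: cst_continuous.
by exists (fun=> 0); split => // x _; exact: is_derive_cst.
Qed.

Lemma Ck_rec_id k U : Ck_rec k U id.
Proof.
case: k => [|k] /=; first by move=> x _; exact: cvg_id.
exists (fun=> 1); split; last exact: Ck_rec_cst.
by move=> x _; exact: is_derive_id.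
Qed.

Lemma Ck_recD k U f g :
  Ck_rec k U f -> Ck_rec k U g -> Ck_rec k U (fun x => f x + g x).
Proof.
elim: k f g => [|k IH] f g /=.
  by move=> cf cg x Ux; apply: continuousD; [exact: cf|exact: cg].
move=> [f' [ff' ckf']] [g' [gg' ckg']]; exists (fun x => f' x + g' x).
by split; [move=> x Ux; apply: is_deriveD; auto|exact: IH].
Qed.

Lemma Ck_recM k U f g :
  Ck_rec k U f -> Ck_rec k U g -> Ck_rec k U (fun x => f x * g x).
Proof.
elim: k f g => [|k IH] f g.
  by move=> cf cg x Ux; apply: continuousM; [exact: cf|exact: cg].
move=> Cf Cg; have Cf0 := Ck_recW Cf; have Cg0 := Ck_recW Cg.
move: Cf Cg => [f' [ff' ckf']] [g' [gg' ckg']].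
exists (fun x => f x * g' x + g x * f' x); split.
  by move=> x Ux; apply: is_deriveM; auto.
by apply: Ck_recD; exact: IH.
Qed.

Lemma Ck_rec_comp k U V f g : (forall x, U x -> V (g x)) ->
  Ck_rec k V f -> Ck_rec k U g -> Ck_rec k U (f \o g).
Proof.
move=> UV; elim: k f => [|k IH] f.
  by move=> cf cg x Ux; apply: continuous_comp; [exact: cg|exact/cf/UV].
move=> Cf Cg; have Cg0 := Ck_recW Cg.
move: Cf Cg => [f' [ff' ckf']] [g' [gg' ckg']].
exists (fun x => (f' \o g) x * g' x); split.
  by move=> x Ux; apply: is_derive1_comp; [exact/ff'/UV|exact: gg'].
by apply: Ck_recM => //; exact: IH.
Qed.

Lemma Ck_recV k : Ck_rec k [set x : R | x != 0] (fun x => x^-1).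
Proof.
elim: k => [|k IH] /=; first by move=> x x0; exact: inv_continuous.
exists (fun x => (-1) * (x^-1 * x^-1)); split => [x /= x0|].
  have := @is_deriveV R id x 1 1 x0 (is_derive_id x 1).
  by rewrite /GRing.scale/= mulr1 expr2 invfM mulN1r.
by apply: Ck_recM; [exact: Ck_rec_cst|exact: Ck_recM].
Qed.

Lemma Ck_rec_expR k U : Ck_rec k U expR.
Proof.
elim: k => [|k IH] /=; first by move=> x _; exact: continuous_expR.
by exists expR; split => // x _; exact: is_derive_expR.
Qed.

Lemma Ck_rec_ln k : Ck_rec k [set x : R | 0 < x] (@ln R).
Proof.
case: k => [|k] /=; first by move=> x x0; exact: continuous_ln.
exists (fun x => x^-1); split; first by move=> x /= x0; exact: is_derive1_ln.
by apply: Ck_rec_sub (Ck_recV k) => x /= x0; rewrite gt_eqF.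
Qed.

(** With the derivative kept as a witness, the product, chain and inverse rules are each one
    induction on [k]; this lemma translates back to the iterated derivatives [derive1n]. Openness of
    [U] lets the witness be replaced by the actual derivative. *)
Lemma Ck_rec_Ck_on k U f : open U -> Ck_rec k U f -> Ck_on k U f.
Proof.
move=> oU; elim: k f => [|k IH] f; first by move=> cf; split.
move=> [f' [ff' ckf']].
have /IH[fd fc] : Ck_rec k U (f^`())%classic.
  apply: Ck_rec_eq ckf' => // x Ux.
  by rewrite derive1E; case: (ff' x Ux) => _ ->.
have E j : (derive1n j.+1 f = derive1n j (f^`()))%classic.
  by rewrite /derive1n -iterSr.
split; last by rewrite E.
move=> [|j] x jk Ux; first by case: (ff' x Ux).
by rewrite E; exact: fd.
Qed.

(** Bootstrap on the formula [psi' = 1 / (f' o psi)]: each order of regularity of [psi] gives the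
    next one. *)
Lemma Ck_rec_left_inverse k U f psi : open U -> Ck_rec k.+1 U f ->
  (forall x, U x -> psi (f x) = x) ->
  (forall x, U x -> 'D_1 f x != 0) ->
  open (f @` U) -> Ck_rec k.+1 (f @` U) psi.
Proof.
move=> oU [f' [ff' ckf']] fK f'0 ofU.
have f'0' x : U x -> f' x != 0.
  by move=> Ux; move: (f'0 x Ux); case: (ff' x Ux) => _ ->.
have psid y : (f @` U) y -> is_derive y 1 psi (f' (psi y))^-1.
  move=> [x Ux <-]; rewrite fK//; apply: is_derive_inverse; last exact: f'0'.
  - near=> z; apply: fK; near: z; exact: open_nbhs_nbhs.
  - near=> z; apply: (@is_derive_continuous _ _ _ (f' z)); apply: ff'.
    near: z; exact: open_nbhs_nbhs.
  - exact: ff'.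
have psiU y : (f @` U) y -> U (psi y) by move=> [x Ux <-]; rewrite fK.
have psi0 : Ck_rec 0 (f @` U) psi.
  by move=> y Uy; exact: is_derive_continuous (psid y Uy).
elim: k ckf' => [|k IH] ckf'.
  exists (fun y => (f' (psi y))^-1); split => //.
  apply: (@Ck_rec_comp 0 _ [set x | x != 0] (fun x => x^-1) (f' \o psi)).
  - by move=> y Uy; exact: (f'0' _ (psiU _ Uy)).
  - exact: Ck_recV.
  - exact: (Ck_rec_comp psiU).
exists (fun y => (f' (psi y))^-1); split => //.
apply: (@Ck_rec_comp k.+1 _ [set x | x != 0] (fun x => x^-1) (f' \o psi)).
- by move=> y Uy; exact: (f'0' _ (psiU _ Uy)).
- exact: Ck_recV.
- by apply: (Ck_rec_comp psiU) => //; apply: IH; exact: Ck_recW.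
Unshelve. all: by end_near. Qed.

End Ck_rec_theory.

(** * Entire power series *)

(** Coefficients of a function of exponential type. Comparison with the exponential series gives
    convergence everywhere, and the bound survives differentiation and the shift of coefficients,
    that is, division by the variable when the constant term vanishes. *)
Definition exp_bounded {R : realType} (a : nat -> R) :=
  exists C M, [/\ 0 <= C, 0 <= M & forall n, `|a n| <= C * (M ^+ n / n`!%:R)].

Definition entire {R : realType} (f : R -> R) :=
  exists a, exp_bounded a /\ forall x, pseries a x @ \oo --> f x.

Section entire_theory.
Context {R : realType}.
Implicit Types (a b : nat -> R) (f g : R -> R).

Lemma exp_bounded_cvg a x : exp_bounded a -> cvgn (pseries a x).
Proof.
move=> [C [M [C0 M0 aCM]]]; apply: normed_cvg.
apply: (@series_le_cvg _ _ (C *: exp_coeff (M * `|x|))).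
- by move=> n; exact: normr_ge0.
- move=> n; rewrite /= mulr_ge0// /exp_coeff/= divr_ge0// exprn_ge0//.
  by rewrite mulr_ge0.
- move=> n; rewrite /= normrM normrX.
  rewrite [leRHS](_ : _ = (C * (M ^+ n / n`!%:R)) * `|x| ^+ n); last first.
    by rewrite -[LHS]/(C * exp_coeff _ n) /exp_coeff/= exprMn; ring.
  by rewrite ler_wpM2r// exprn_ge0.
- by apply: is_cvg_seriesZ; exact: is_cvg_series_exp_coeff.
Qed.

Lemma exp_bounded_shift a : exp_bounded a -> exp_bounded (fun n => a n.+1).
Proof.
move=> [C [M [C0 M0 aCM]]]; exists (C * M), M; split => //.
  exact: mulr_ge0.
move=> n; apply: le_trans (aCM n.+1) _.
rewrite -mulrA ler_wpM2l// exprS -mulrA ler_wpM2l// ler_wpM2l ?exprn_ge0//.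
by rewrite lef_pV2 ?posrE ?ltr0n ?fact_gt0// ler_nat factS leq_pmull.
Qed.

Lemma exp_bounded_diffs a : exp_bounded a -> exp_bounded (pseries_diffs a).
Proof.
move=> [C [M [C0 M0 aCM]]]; exists (C * M), M; split => //.
  exact: mulr_ge0.
move=> n; rewrite /pseries_diffs normrM ger0_norm//.
apply: le_trans (ler_wpM2l _ (aCM n.+1)) _ => //.
rewrite le_eqVlt; apply/orP; left; apply/eqP.
rewrite factS natrM exprS; field.
by rewrite pnatr_eq0 -lt0n fact_gt0 nat1r pnatr_eq0.
Qed.

Lemma exp_boundedD a b :
  exp_bounded a -> exp_bounded b -> exp_bounded (fun n => a n + b n).
Proof.
move=> [C [M [C0 M0 aCM]]] [C' [M' [C'0 M'0 aCM']]].
exists (C + C'), (M + M'); split; rewrite ?addr_ge0// => n.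
apply: le_trans (ler_normD _ _) _; rewrite mulrDl lerD//.
  apply: le_trans (aCM n) _; rewrite ler_wpM2l// ler_wpM2r//.
  by rewrite lerXn2r ?nnegrE ?addr_ge0// lerDl.
apply: le_trans (aCM' n) _; rewrite ler_wpM2l// ler_wpM2r//.
by rewrite lerXn2r ?nnegrE ?addr_ge0// lerDr.
Qed.

Lemma exp_boundedM c a : exp_bounded a -> exp_bounded (fun n => c * a n).
Proof.
move=> [C [M [C0 M0 aCM]]]; exists (`|c| * C), M; split => //.
  by rewrite mulr_ge0.
by move=> n; rewrite normrM -mulrA ler_wpM2l.
Qed.

Lemma exp_bounded_geo k a : exp_bounded a -> exp_bounded (fun n => a n * k ^+ n).
Proof.
move=> [C [M [C0 M0 aCM]]]; exists C, (M * `|k|); split => //.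
  by rewrite mulr_ge0.
move=> n; rewrite normrM normrX exprMn.
apply: le_trans (ler_wpM2r _ (aCM n)) _; first by rewrite exprn_ge0.
by rewrite le_eqVlt; apply/orP; left; apply/eqP; ring.
Qed.

Lemma entireD f g : entire f -> entire g -> entire (fun x => f x + g x).
Proof.
move=> [a [ba fa]] [b [bb gb]]; exists (fun n => a n + b n); split.
  exact: exp_boundedD.
move=> x; rewrite (_ : pseries _ x = pseries a x \+ pseries b x).
  by apply: cvgD; [exact: fa|exact: gb].
apply/funext => n; rewrite [RHS]/=.
rewrite /pseries/= !seriesEnat/= -big_split/=.
by apply: eq_bigr => i _; rewrite mulrDl.
Qed.

Lemma entireM c f : entire f -> entire (fun x => c * f x).
Proof.
move=> [a [ba fa]]; exists (fun n => c * a n); split; first exact: exp_boundedM.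
move=> x; rewrite (_ : pseries _ x = cst c \* pseries a x).
  by apply: cvgM; [exact: cvg_cst|exact: fa].
apply/funext => n; rewrite [RHS]/=.
rewrite /pseries/= !seriesEnat/= mulr_sumr.
by apply: eq_bigr => i _; rewrite mulrA.
Qed.

Lemma entire_scale k f : entire f -> entire (fun x => f (k * x)).
Proof.
move=> [a [ba fa]]; exists (fun n => a n * k ^+ n); split.
  exact: exp_bounded_geo.
move=> x; rewrite (_ : pseries _ x = pseries a (k * x)); first exact: fa.
apply/funext => n.
rewrite /pseries/= !seriesEnat/=.
by apply: eq_bigr => i _; rewrite exprMn mulrA.
Qed.

Lemma entire_cvg f a : exp_bounded a -> (forall x, f x = limn (pseries a x)) ->
  entire f.
Proof.
by move=> ba fa; exists a; split => // x; rewrite fa; exact: exp_bounded_cvg.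
Qed.

Lemma pseriesS a x n :
  pseries a x n.+1 = a 0%N + x * pseries (fun n => a n.+1) x n.
Proof.
rewrite /pseries/= !seriesEnat/= big_nat_recl//= expr0 mulr1; congr (_ + _).
by rewrite mulr_sumr; apply: eq_bigr => i _; rewrite exprS mulrCA.
Qed.

Lemma entire_coef0 f a :
  (forall x, pseries a x @ \oo --> f x) -> f 0 = a 0%N.
Proof.
move=> /(_ 0); rewrite -cvg_shiftS => fa.
apply: (cvg_unique _ fa) => //.
rewrite (_ : (fun n => _) = cst (a 0%N)); first exact: cvg_cst.
by apply/funext => n; rewrite pseriesS mul0r addr0.
Qed.

Lemma entire_divX f a : exp_bounded a -> (forall x, pseries a x @ \oo --> f x) ->
  a 0%N = 0 -> forall x, f x = x * limn (pseries (fun n => a n.+1) x).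
Proof.
move=> ba fa a0 x; have /= := fa x; rewrite -cvg_shiftS => fx.
apply: (cvg_unique _ fx) => //.
have ca : cvgn (pseries (fun n => a n.+1) x).
  by apply: exp_bounded_cvg; exact: exp_bounded_shift.
rewrite (_ : (fun n => _) = cst x \* pseries (fun n => a n.+1) x).
  by apply: cvgM; [exact: cvg_cst|exact: ca].
by apply/funext => n; rewrite pseriesS a0 add0r.
Qed.

Lemma entire_is_derive f a : exp_bounded a ->
  (forall x, pseries a x @ \oo --> f x) ->
  forall x : R, is_derive x 1 f (limn (pseries (pseries_diffs a) x)).
Proof.
move=> ba fa x.
rewrite (_ : f = fun x => limn (pseries a x)); last first.
  by apply/funext => y; apply/esym/cvg_lim => //; exact: fa.
have b1 := exp_bounded_diffs ba; have b2 := exp_bounded_diffs b1.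
apply: (@pseries_snd_diffs _ _ (`|x| + 1)); try exact: exp_bounded_cvg.
by rewrite [ltRHS]ger0_norm ?addr_ge0// ltrDl.
Qed.

Lemma entire_Ck k U f : entire f -> Ck_rec k U f.
Proof.
elim: k f => [|k IH] f [a [ba fa]] /=.
  by move=> x _; exact: is_derive_continuous (entire_is_derive ba fa x).
exists (fun x => limn (pseries (pseries_diffs a) x)); split.
  by move=> x _; exact: entire_is_derive.
by apply: IH; apply: entire_cvg => //; exact: exp_bounded_diffs.
Qed.

(** The three vanishing values kill the coefficients of order 0, 1 and 2, so [u] is the series
    shifted three times; its constant term is the third Taylor coefficient [f3 / 6]. *)
Lemma entire_cube f f1 f2 (f3 : R) : entire f ->
  (forall x : R, is_derive x 1 f (f1 x)) -> (forall x : R, is_derive x 1 f1 (f2 x)) ->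
  is_derive (0 : R) 1 f2 f3 ->
  f 0 = 0 -> f1 0 = 0 -> f2 0 = 0 ->
  exists u, [/\ entire u, forall x, f x = x ^+ 3 * u x & 6 * u 0 = f3].
Proof.
move=> [a [ba fa]] ff1 ff2 ff3 f0 f10 f20.
have step g g1 b : exp_bounded b -> (forall x, pseries b x @ \oo --> g x) ->
  (forall x : R, is_derive x 1 g (g1 x)) ->
  forall x, pseries (pseries_diffs b) x @ \oo --> g1 x.
  move=> bb gb gg1 x; rewrite (is_derive_unique (gg1 x) (entire_is_derive bb gb x)).
  by apply: exp_bounded_cvg; exact: exp_bounded_diffs.
have b1 := exp_bounded_diffs ba; have b2 := exp_bounded_diffs b1.
have b3 := exp_bounded_diffs b2.
have fa1 := step _ _ _ ba fa ff1; have fa2 := step _ _ _ b1 fa1 ff2.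
have a0 : a 0%N = 0 by rewrite -(entire_coef0 fa).
have a1 : a 1%N = 0.
  by move: f10; rewrite (entire_coef0 fa1) /pseries_diffs mul1r.
have a2 : a 2%N = 0.
  move: f20; rewrite (entire_coef0 fa2) /pseries_diffs mul1r => /eqP.
  by rewrite mulf_eq0 pnatr_eq0 => /eqP.
have a3 : f3 = 6 * a 3%N.
  rewrite (is_derive_unique ff3 (entire_is_derive b2 fa2 0)).
  rewrite (@entire_coef0 (fun x => limn (pseries (pseries_diffs
    (pseries_diffs (pseries_diffs a))) x)) (pseries_diffs
    (pseries_diffs (pseries_diffs a))))//.
    by rewrite /pseries_diffs mul1r mulrA; congr (_ * _); ring.
  by move=> x; exact: exp_bounded_cvg.
have s1 := exp_bounded_shift ba; have s2 := exp_bounded_shift s1.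
have s3 := exp_bounded_shift s2.
have lc b x : exp_bounded b -> pseries b x @ \oo --> limn (pseries b x).
  by move=> bb; exact: exp_bounded_cvg.
exists (fun x => limn (pseries (fun n => a n.+3) x)); split.
- exact: entire_cvg s3 _.
- move=> x; rewrite (entire_divX ba fa)//.
  rewrite (@entire_divX (fun x => limn (pseries (fun n => a n.+1) x)) _ s1)//;
    last by move=> y; exact: lc.
  rewrite (@entire_divX (fun x => limn (pseries (fun n => a n.+2) x)) _ s2)//;
    last by move=> y; exact: lc.
  by rewrite !exprS expr0; ring.
- rewrite (@entire_coef0 (fun x => limn (pseries (fun n => a n.+3) x))
    (fun n => a n.+3)) ?a3// => x; exact: lc.
Qed.

Lemma exp_bounded_fin a N : (forall n, (N <= n)%N -> a n = 0) -> exp_bounded a.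
Proof.
move=> a0; have s0 : 0 <= \sum_(i < N) `|a i| * i`!%:R.
  by apply: sumr_ge0 => i _; rewrite mulr_ge0.
exists (\sum_(i < N) `|a i| * i`!%:R), 1; split => // n.
rewrite expr1n mul1r; have [nN|Nn] := ltnP n N; last first.
  by rewrite a0// normr0 mulr_ge0// invr_ge0.
rewrite ler_pdivlMr ?ltr0n ?fact_gt0// (bigD1 (Ordinal nN))//= lerDl.
by apply: sumr_ge0 => i _; rewrite mulr_ge0.
Qed.

Lemma entire_cst (c : R) : entire (fun=> c).
Proof.
exists (fun n => if n is 0%N then c else 0); split.
  by apply: (@exp_bounded_fin _ 1) => -[].
move=> x; rewrite -cvg_shiftS/= (_ : (fun n => _) = cst c).
  exact: cvg_cst.
apply/funext => n; rewrite pseriesS.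
rewrite /pseries/= seriesEnat/= big1 ?mulr0 ?addr0// => i _; exact: mul0r.
Qed.

Lemma entire_id : entire (@id R).
Proof.
exists (fun n => if n is 1%N then 1 else 0); split.
  by apply: (@exp_bounded_fin _ 2) => -[|[]].
move=> x; rewrite -(cvg_shiftn 2)/= (_ : (fun n => _) = cst x).
  exact: cvg_cst.
apply/funext => n; rewrite addn2 !pseriesS.
rewrite /pseries/= seriesEnat/= big1 ?mulr0 ?addr0 ?mulr1 ?add0r// => i _.
exact: mul0r.
Qed.

Lemma entire_sin : entire (@sin R).
Proof.
rewrite sinE; apply: entire_cvg => //; exists 1, 1; split => // n.
rewrite expr1n !mul1r !normrM normrX normrN1 expr1n mulr1.
rewrite [X in _ * X <= _]ger0_norm ?invr_ge0//.
by case: (odd n); rewrite ?normr1 ?mul1r// normr0 mul0r invr_ge0.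
Qed.

Lemma entire_cos : entire (@cos R).
Proof.
rewrite cosE; apply: entire_cvg => //; exists 1, 1; split => // n.
rewrite expr1n !mul1r !normrM normrX normrN1 expr1n mulr1.
rewrite [X in _ * X <= _]ger0_norm ?invr_ge0//.
by case: (odd n); rewrite ?normr1 ?mul1r// normr0 mul0r invr_ge0.
Qed.

Lemma entire_sin_affine (k b : R) : entire (fun x => sin (k * x + b)).
Proof.
rewrite (_ : (fun x => _) =
    (fun x => cos b * sin (k * x) + sin b * cos (k * x))); last first.
  by apply/funext => x; rewrite sinD; ring.
by apply: entireD; apply: entireM; apply: entire_scale;
  [exact: entire_sin|exact: entire_cos].
Qed.

End entire_theory.

(** * Cubic critical points *)

Section local_diffeo.
Context {R : realType}.
Implicit Types (f psi : R -> R) (U : set R).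

(** Invariance of domain in dimension one: near [f x] the left inverse is continuous and also a
    right inverse, so points close to [f x] are images of points of [U]. *)
Lemma open_image_left_inverse U f psi : open U ->
  (forall x, U x -> {for x, continuous f}) ->
  (forall x, U x -> psi (f x) = x) -> open (f @` U).
Proof.
move=> oU cf fK; rewrite openE => y [x Ux <-].
have nU : \forall z \near x, U z by exact: open_nbhs_nbhs.
have [cpsi psiK] : {near f x, continuous psi} /\ {near f x, cancel psi f}.
  apply: near_can_continuousAcan_sym; first by apply: filterS nU.
  by apply: filterS nU.
have : \forall z \near f x, U (psi z).
  have := nbhs_singleton cpsi; rewrite /continuous_at fK//.
  by move/(_ U); apply.
rewrite /interior/= => Upsi; apply: filterS2 Upsi psiK => z Uz zK.
by exists (psi z).
Qed.

Lemma injective_pos_derive f f' (c r : R) :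
  (forall x, ball c r x -> is_derive x 1 f (f' x)) ->
  (forall x, ball c r x -> 0 < f' x) ->
  forall x y, ball c r x -> ball c r y -> f x = f y -> x = y.
Proof.
move=> ff' f'0; have lt x y : ball c r x -> ball c r y -> x < y -> f x < f y.
  move=> cx cy xy.
  have B z : z \in `[x, y] -> ball c r z.
    rewrite in_itv/= => /andP[xz zy]; move: cx cy; rewrite /ball/= !ltr_norml.
    by move=> /andP[? ?] /andP[? ?]; apply/andP; split; lra.
  have [| |z zxy E] := @MVT R f f' x y xy.
  - by move=> z zxy; apply/ff'/B/subset_itv_oo_cc.
  - apply: continuous_in_subspaceT => z /[!inE]/= zxy.
    exact: is_derive_continuous (ff' z (B z zxy)).
  - rewrite -subr_gt0 E mulr_gt0 ?subr_gt0//.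
    exact/f'0/B/subset_itv_oo_cc.
move=> x y cx cy fxy; apply/eqP; rewrite eq_le !leNgt.
apply/andP; split; apply/negP => /lt.
  by move=> /(_ cy cx); rewrite fxy ltxx.
by move=> /(_ cx cy); rewrite fxy ltxx.
Qed.

Lemma Ck_diffeo_on_pos_derive k f (f' : R -> R) (c r : R) :
  (forall x, ball c r x -> is_derive x 1 f (f' x)) ->
  (forall x, ball c r x -> 0 < f' x) ->
  Ck_rec k.+1 (ball c r) f -> Ck_diffeo_on k.+1 (ball c r) f.
Proof.
move=> ff' f'0 Cf.
pose psi y := xget c [set x | ball c r x /\ f x = y].
have fK x : ball c r x -> psi (f x) = x.
  move=> cx; rewrite /psi; case: xgetP => [z -> [cz fz]|/(_ x)[]//].
  exact: (injective_pos_derive ff' f'0 cz cx fz).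
have oU : open (ball c r) by exact: ball_open.
have oV : open (f @` ball c r).
  apply: (open_image_left_inverse oU _ fK) => x cx.
  exact: is_derive_continuous (ff' x cx).
split => //; first exact: Ck_rec_Ck_on.
exists psi; split => //; apply: Ck_rec_Ck_on => //.
apply: Ck_rec_left_inverse => // x cx.
by case: (ff' x cx) => _ ->; rewrite gt_eqF// f'0.
Qed.

(* The coordinate at [c] is [y * u(y) ^ (1/3)] with [y = x - c]. *)
Lemma nonflat_cube (F u : R -> R) (c : R) :
  (forall y, F (c + y) = F c + y ^+ 3 * u y) ->
  (forall k, Ck_rec k setT u) -> 0 < u 0 -> nonflat_at F c 3.
Proof.
move=> Fu Cu u0.
pose U := [set y | 0 < u y]; pose f y := y * expR (3^-1 * ln (u y)).
have oU : open U.
  rewrite (_ : U = u @^-1` [set x | 0 < x])//.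
  by apply: open_comp; [move=> y _; exact: (Cu 0%N)|exact: open_gt].
have Cr k : Ck_rec k U (fun y => expR (3^-1 * ln (u y))).
  apply: (@Ck_rec_comp R k _ setT expR) => //; first exact: Ck_rec_expR.
  apply: Ck_recM; first exact: Ck_rec_cst.
  apply: (@Ck_rec_comp R k _ [set x | 0 < x] (@ln R) u) => //.
    exact: Ck_rec_ln.
  exact: Ck_rec_sub (Cu k).
have Cf k : Ck_rec k U f by apply: Ck_recM; [exact: Ck_rec_id|exact: Cr].
have [f' [ff' cf']] := Cf 1%N.
(* In the product rule at 0 the term carrying the factor [y] vanishes, leaving the cube root of
   [u 0]. *)
have f'0 : 0 < f' 0.
  have [r' [rr' _]] := Cr 1%N.
  have D := is_deriveM (is_derive_id (0 : R) 1) (rr' 0 u0).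
  rewrite (is_derive_unique (ff' 0 u0) D) /= scale0r add0r /GRing.scale/= mulr1.
  exact: expR_gt0.
have : \forall y \near (0 : R), U y /\ 0 < f' y.
  near=> y; split; near: y; first exact: open_nbhs_nbhs.
  by apply: (cvgr_gt (f' 0)) => //; exact: cf'.
move=> /nbhs_ballP[r /= r0 rU].
have sh x : ball c r x -> ball 0 r (x - c).
  by rewrite /ball/= sub0r opprB.
have ffc x : ball c r x -> is_derive x 1 (fun x => f (x - c)) (f' (x - c)).
  move=> cx; rewrite -[f' _]mulr1.
  apply: (@is_derive1_comp _ f (fun x => x - c)).
    by apply: ff'; case: (rU _ (sh _ cx)).
  by rewrite -[X in is_derive _ _ _ X]subr0; apply: is_deriveB.
exists (ball c r), (fun x => f (x - c)); split.
- exact: ballxx.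
- apply: (Ck_diffeo_on_pos_derive ffc) => [x cx|].
    by case: (rU _ (sh _ cx)).
  apply: (@Ck_rec_comp R 3 _ U f (fun x => x - c)).
  + by move=> x cx; case: (rU _ (sh _ cx)).
  + exact: Cf.
  + by apply: Ck_recD; [exact: Ck_rec_id|exact: Ck_rec_cst].
- by rewrite /f subrr mul0r.
- move=> x cx; have [ux _] := rU _ (sh _ cx).
  rewrite -{1}(subrK c x) addrC Fu; congr (_ + _).
  (* The real power with exponent [3 - 1] is an ordinary square, so the normal form is the cube of
     the coordinate, and the cube of [expR (3^-1 * ln (u y))] is [u y]. *)
  rewrite (_ : 3 - 1 = 2%:R :> R); last by ring.
  rewrite powR_mulrn// real_normK ?num_real// /f.
  rewrite -exprS exprMn -expRM_natl mulrA divff ?mul1r ?lnK//.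
Unshelve. all: by end_near. Qed.

End local_diffeo.

(** * The trigonometric family *)

Section trig_family.
Context {R : realType}.
Implicit Types x y b t : R.

Local Notation kappa := (pi *+ 2 : R).

Lemma kappa_gt0 : 0 < kappa.
Proof. by rewrite pmulrn_lgt0// pi_gt0. Qed.

Lemma cos_2piDint x n : n \is a Num.int -> cos (kappa * (x + n)) = cos (kappa * x).
Proof.
have H m y : cos (kappa * (y + m%:R)) = cos (kappa * y).
  by rewrite mulrDr mulr_natr (periodicn (@cosD2pi R)).
move=> /intrP[[m|m] ->]; first exact: H.
by rewrite NegzE mulrNz -[in RHS](subrK m.+1%:R x) H.
Qed.

Lemma sin_2piDint x n : n \is a Num.int -> sin (kappa * (x + n)) = sin (kappa * x).
Proof.
have H m y : sin (kappa * (y + m%:R)) = sin (kappa * y).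
  by rewrite mulrDr mulr_natr (periodicn (@sinD2pi R)).
move=> /intrP[[m|m] ->]; first exact: H.
by rewrite NegzE mulrNz -[in RHS](subrK m.+1%:R x) H.
Qed.

Lemma cos_2pi_eq1 x : cos (kappa * x) = 1 <-> x \is a Num.int.
Proof.
split; last by move=> xi; rewrite -[x]add0r cos_2piDint// mulr0 cos0.
move=> c1; pose r := x - (Num.floor x)%:~R.
have /andP[r0 r1] : 0 <= r < 1.
  have := floor_itv x; rewrite intrD => /andP[? ?].
  by apply/andP; split; rewrite /r; lra.
(* The double angle formula halves the angle, bringing it into [[0, pi[], where the sine vanishes
   only at 0. *)
have s0 : sin (pi * r) = 0.
  have : cos (kappa * r) = 1.
    by rewrite /r cos_2piDint ?rpredN ?intr_int.
  rewrite mulrnAl cos_mulr2n => E.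
  apply/eqP; rewrite -sqrf_eq0 sin2cos2; apply/eqP.
  by move: E; rewrite mulr2n; lra.
have [r00|r0'] := eqVneq r 0.
  have xE : x = (Num.floor x)%:~R by move: r00; rewrite /r; lra.
  by rewrite xE intr_int.
suff : 0 < sin (pi * r) by rewrite s0 ltxx.
apply: sin_gt0_pi; rewrite mulr_gt0 ?pi_gt0 ?lt_neqAle ?(eq_sym 0) ?r0'//=.
by rewrite -lt_neqAle gtr_pMr ?pi_gt0.
Qed.

Lemma is_derive_sin_affine (k b x : R) :
  is_derive x 1 (fun y => sin (k * y + b)) (k * cos (k * x + b)).
Proof.
rewrite mulrC; apply: (@is_derive1_comp _ sin (fun y => k * y + b)).
rewrite -[X in is_derive _ _ _ X]addr0; apply: is_deriveD.
by have := is_deriveZ k (is_derive_id x 1); rewrite /GRing.scale/= mulr1.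
Qed.

Lemma is_derive_cos_affine (k b x : R) :
  is_derive x 1 (fun y => cos (k * y + b)) (- k * sin (k * x + b)).
Proof.
rewrite mulNr mulrC -mulNr; apply: (@is_derive1_comp _ cos (fun y => k * y + b)).
rewrite -[X in is_derive _ _ _ X]addr0; apply: is_deriveD.
by have := is_deriveZ k (is_derive_id x 1); rewrite /GRing.scale/= mulr1.
Qed.

Lemma is_derive_cst_mul (k : R) (f : R -> R) (x df : R) : is_derive x 1 f df ->
  is_derive x 1 (fun y => k * f y) (k * df).
Proof. by move=> H; have := is_deriveZ k H. Qed.

(** Inverse of the mean of [(1 - cos 2 pi x) (1 - cos 2 pi (x - t))] over a period, which is
    [1 + cos (2 pi t) / 2]. The normalized derivative has mean 1, so its primitive has degree
    one. *)
Definition trig_speed t : R := 2 / (2 + cos (kappa * t)).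

(* Normalized primitive of [(1 - cos 2 pi x) (1 - cos 2 pi (x - t))]. *)
Definition trig_lift t x : R :=
  x + trig_speed t / kappa * ((-1) * sin (kappa * x + 0)
      + ((-1) * sin (kappa * x + - (kappa * t))
         + 4^-1 * sin (2 * kappa * x + - (kappa * t)))).

Lemma trig_den_gt0 t : 0 < 2 + cos (kappa * t).
Proof. by have := cos_geN1 (kappa * t); lra. Qed.

Lemma trig_speed_gt0 t : 0 < trig_speed t.
Proof. by rewrite /trig_speed divr_gt0// trig_den_gt0. Qed.

Lemma is_derive_trig_lift t x : is_derive x 1 (trig_lift t)
  (trig_speed t * ((1 - cos (kappa * x)) * (1 - cos (kappa * (x - t))))).
Proof.
have D := is_deriveD (is_derive_id x 1) (is_derive_cst_mul (trig_speed t / kappa)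
  (is_deriveD (is_derive_cst_mul (-1) (is_derive_sin_affine kappa 0 x))
    (is_deriveD (is_derive_cst_mul (-1) (is_derive_sin_affine kappa (- (kappa * t)) x))
    (is_derive_cst_mul 4^-1 (is_derive_sin_affine (2 * kappa) (- (kappa * t)) x))))).
apply: (is_derive_eq D); rewrite addr0 -mulrBr.
have -> : 2 * kappa * x + - (kappa * t) = kappa * x + kappa * (x - t) by ring.
rewrite cosD.
(* Once [2 pi t] is split as a difference of the two angles [2 pi x] and [2 pi (x - t)], the claim
   is a rational identity in their sines and cosines. *)
have ct : cos (kappa * t) = cos (kappa * x) * cos (kappa * (x - t)) +
    sin (kappa * x) * sin (kappa * (x - t)).
  by rewrite -cosB; congr cos; ring.
have k0 := lt0r_neq0 kappa_gt0; have d0 := lt0r_neq0 (trig_den_gt0 t).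
move: d0; rewrite /trig_speed ct => d0; move: k0 d0.
move: (pi *+ 2) => K k0 d0.
by field; rewrite k0 d0.
Qed.

Lemma trig_liftD t x n : n \is a Num.int -> trig_lift t (x + n) = trig_lift t x + n.
Proof.
move=> nint; rewrite /trig_lift !addr0 -!mulrBr.
have -> : 2 * kappa * (x + n) + - (kappa * t) = kappa * (2 * x - t + 2 * n) by ring.
have -> : 2 * kappa * x + - (kappa * t) = kappa * (2 * x - t) by ring.
have -> : x + n - t = x - t + n by ring.
have n2 : 2 * n \is a Num.int by rewrite rpredM// rpred_nat.
by rewrite !(sin_2piDint _ nint) (sin_2piDint _ n2); ring.
Qed.

Lemma trig_lift_crit t x :
  is_derive x 1 (trig_lift t) 0 <-> x \is a Num.int \/ x - t \is a Num.int.
Proof.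
have D := is_derive_trig_lift t x; split.
  move=> /(is_derive_unique D)/eqP; rewrite mulf_eq0 gt_eqF ?trig_speed_gt0//= mulf_eq0.
  by rewrite !subr_eq0 => /orP[]/eqP/esym h; [left|right]; apply: (cos_2pi_eq1 _).1.
move=> H; apply: (is_derive_eq D); apply/eqP.
rewrite mulf_eq0 gt_eqF ?trig_speed_gt0//= mulf_eq0 !subr_eq0.
by apply/orP; case: H => /(cos_2pi_eq1 _).2 ->; [left|right].
Qed.

Lemma trig_lift_continuous t : continuous (trig_lift t).
Proof. by move=> x; exact: is_derive_continuous (is_derive_trig_lift t x). Qed.

Lemma trig_lift_le t : {homo trig_lift t : x y / x <= y}.
Proof.
move=> x y; rewrite le_eqVlt => /predU1P[->//|xy].
have [|z _ E] := MVT xy (fun z _ => is_derive_trig_lift t z).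
  by apply: continuous_subspaceT; exact: trig_lift_continuous.
rewrite -subr_ge0 E mulr_ge0 ?subr_ge0 ?(ltW xy)//.
by rewrite mulr_ge0 ?(ltW (trig_speed_gt0 t))// mulr_ge0 ?subr_ge0 ?cos_le1.
Qed.

Lemma int_dist_lt1 x y : x \is a Num.int -> y \is a Num.int ->
  x < y -> y < x + 1 -> False.
Proof.
move=> /intrP[m ->] /intrP[n ->]; rewrite ltr_int -intrD1 ltr_int ltzD1.
by rewrite ltNge => /negP.
Qed.

(* The derivative vanishes only on [Z] and [t + Z], so two of three points of a
   short interval of constancy would differ by an integer. *)
Lemma trig_lift_lt t : {homo trig_lift t : x y / x < y}.
Proof.
move=> x y xy; rewrite lt_neqAle trig_lift_le ?andbT; last exact: ltW.
(* This spacing keeps [x + e], [x + 2 e] and [x + 3 e] strictly between [x] and [y] and less than 1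
   apart. *)
apply/eqP => E; pose e := Num.min 1 (y - x) / 4.
have e0 : 0 < e by rewrite divr_gt0// lt_min ltr01 subr_gt0.
have e1 : e * 4 <= 1 by rewrite divfK// ge_min lexx.
have e2 : e * 4 <= y - x by rewrite divfK// ge_min lexx orbT.
have H z : x < z -> z < y -> z \is a Num.int \/ z - t \is a Num.int.
  move=> xz zy; apply/trig_lift_crit.
  apply: (@is_derive_open_eq _ [set` `]x, y[] (fun=> trig_lift t x)).
  - exact: interval_open.
  - by rewrite /= in_itv/= xz.
  - move=> w; rewrite /= in_itv/= => /andP[/ltW xw /ltW wy].
    by apply/eqP; rewrite eq_le trig_lift_le//= E trig_lift_le.
case: (H (x + e)) (H (x + e *+ 2)) (H (x + e *+ 3)) => [||h1|h1]; try lra.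
all: case => [||h2|h2]; try lra.
all: case => [||h3|h3]; try lra.
all: try (by apply: (int_dist_lt1 h1 h2); lra).
all: try (by apply: (int_dist_lt1 h1 h3); lra).
all: by apply: (int_dist_lt1 h2 h3); lra.
Qed.

Lemma trig_lift_Ck k t : Ck_rec k setT (trig_lift t).
Proof.
by apply: entire_Ck; apply: entireD; [exact: entire_id|apply: entireM;
  apply: entireD; [|apply: entireD]; apply: entireM; exact: entire_sin_affine].
Qed.

(** One computation serves both critical points: recentred at [c], the derivative is proportional to
    [(1 - cos 2 pi y) (1 - cos 2 pi (y + b))], where [b] is the offset between the two points
    reduced modulo 1. Its second derivative at 0 is [trig_speed t * (2 pi)^2 * (1 - cos 2 pi b)],
    positive because [b] is not an integer. *)
Lemma trig_lift_cube t c b : 0 <= b < 1 -> b != 0 ->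
  (c = 0 /\ b = 1 - t) \/ (c = t /\ b = t) ->
  exists u, [/\ forall y, trig_lift t (c + y) = trig_lift t c + y ^+ 3 * u y,
    forall k, Ck_rec k setT u & 0 < u 0].
Proof.
move=> b01 b0 cb; pose f y := trig_lift t (c + y) + - trig_lift t c.
pose f1 y := trig_speed t *
  ((1 - cos (kappa * y + 0)) * (1 - cos (kappa * y + kappa * b))).
have ff1 y : is_derive y 1 f (f1 y).
  rewrite -[X in is_derive _ _ _ X]addr0; apply: is_deriveD.
  rewrite -[X in is_derive _ _ _ X]mulr1.
  apply: (@is_derive1_comp _ (trig_lift t) (fun y => c + y)); last first.
    by rewrite -[X in is_derive _ _ _ X]add0r; apply: is_deriveD.
  have := is_derive_trig_lift t (c + y); rewrite /f1 addr0 -mulrDr.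
  case: cb => -[-> ->].
    by rewrite add0r -(@cos_2piDint (y - t) 1)// (_ : y - t + 1 = y + (1 - t))//; ring.
  by rewrite (mulrC (1 - cos (_ * (t + y)))) (addrC t y) addrK.
pose f2 y := trig_speed t *
  ((1 - cos (kappa * y + 0)) * (kappa * sin (kappa * y + kappa * b)) +
   (1 - cos (kappa * y + kappa * b)) * (kappa * sin (kappa * y + 0))).
have D1 h y : is_derive y 1 (fun y => 1 - cos (kappa * y + h)) (kappa * sin (kappa * y + h)).
  apply: (is_derive_eq (is_deriveB (is_derive_cst (1 : R) y 1)
    (is_derive_cos_affine kappa h y))).
  by ring.
have f1f2 y : is_derive y 1 f1 (f2 y).
  by apply: is_derive_cst_mul; apply: is_deriveM; exact: D1.
have D2 h y : is_derive y 1 (fun y => kappa * sin (kappa * y + h))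
    (kappa * (kappa * cos (kappa * y + h))).
  by apply: is_derive_cst_mul; exact: is_derive_sin_affine.
have f2f3 := is_derive_cst_mul (trig_speed t)
   (is_deriveD (is_deriveM (D1 0 0) (D2 (kappa * b) 0))
      (is_deriveM (D1 (kappa * b) 0) (D2 0 0))).
have ef : entire f.
  rewrite (_ : f = fun y => (y + c) + (trig_speed t / kappa * ((-1) * sin (kappa * y + kappa * c)
      + ((-1) * sin (kappa * y + (kappa * c - (kappa * t)))
         + 4^-1 * sin (2 * kappa * y + (2 * kappa * c - (kappa * t))))) - trig_lift t c)).
    apply: entireD; first by apply: entireD; [exact: entire_id|exact: entire_cst].
    apply: entireD; last exact: entire_cst.
    by apply: entireM; apply: entireD; [|apply: entireD]; apply: entireM;
      exact: entire_sin_affine.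
  apply/funext => y; rewrite /f {1}/trig_lift addr0.
  have -> : kappa * (c + y) = kappa * y + kappa * c by ring.
  have -> : kappa * y + kappa * c + - (kappa * t) =
            kappa * y + (kappa * c - kappa * t) by ring.
  have -> : 2 * kappa * (c + y) + - (kappa * t) =
            2 * kappa * y + (2 * kappa * c - kappa * t) by ring.
  by ring.
have f0 : f 0 = 0 by rewrite /f addr0 subrr.
have f10 : f1 0 = 0 by rewrite /f1 mulr0 addr0 cos0 subrr mul0r mulr0.
have f20 : f2 0 = 0.
  by rewrite /f2 mulr0 addr0 cos0 sin0 subrr mul0r !mulr0 addr0 mulr0.
have [u [eu fu u0]] := entire_cube ef ff1 f1f2 f2f3 f0 f10 f20.
exists u; split.
- by move=> y; rewrite -fu /f; ring.
- by move=> k; exact: entire_Ck.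
- rewrite -(@pmulr_rgt0 _ 6)// u0.
  rewrite mulr0 !addr0 add0r cos0 sin0 subrr !(mulr0, mul0r, mulr1, add0r).
  rewrite /GRing.scale/= !(mulr0, mul0r, mulr1, add0r, addr0).
  have cb1 : cos (kappa * b) < 1.
    rewrite lt_neqAle cos_le1 andbT; apply/eqP => /(cos_2pi_eq1 _).1 bi.
    apply: (@int_dist_lt1 0 b) => //; case/andP: b01 => b0' b1.
      by rewrite lt_neqAle eq_sym b0.
    by rewrite add0r.
  rewrite mulr_gt0 ?trig_speed_gt0// mulr_gt0 ?subr_gt0//.
  by rewrite mulr_gt0 ?kappa_gt0.
Qed.

(* Writing [trig_lift t] in the basis [sin 2 pi x], [cos 2 pi x], [sin 4 pi x],
   [cos 4 pi x] makes the dependence on [t] uniform in [x]. *)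
Lemma trig_lift_unif t (e : R) : 0 < e ->
  \forall s \near t, forall x, `|trig_lift s x - trig_lift t x| <= e.
Proof.
move=> e0; pose p s := trig_speed s / kappa.
pose q s := p s * cos (kappa * s); pose r s := p s * sin (kappa * s).
have ck : continuous (fun s : R => kappa * s).
  by move=> s; apply: cvgM; [exact: cvg_cst|exact: cvg_id].
have cc : continuous (fun s : R => cos (kappa * s)).
  by move=> s; apply: (@continuous_comp _ _ _ (fun s : R => kappa * s) cos);
    [exact: ck|exact: continuous_cos].
have cs : continuous (fun s : R => sin (kappa * s)).
  by move=> s; apply: (@continuous_comp _ _ _ (fun s : R => kappa * s) sin);
    [exact: ck|exact: continuous_sin].
have cp : continuous p.
  move=> s; apply: cvgM; last exact: cvg_cst.
  apply: cvgM; first exact: cvg_cst.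
  apply: cvgV; first by rewrite gt_eqF// trig_den_gt0.
  by apply: cvgD; [exact: cvg_cst|exact: cc].
have cq : continuous q by move=> s; apply: cvgM; [exact: cp|exact: cc].
have cr : continuous r by move=> s; apply: cvgM; [exact: cp|exact: cs].
have E s x : trig_lift s x - trig_lift t x =
   - (p s - p t) * sin (kappa * x) - (q s - q t) * sin (kappa * x)
   + (r s - r t) * cos (kappa * x) + (q s - q t) / 4 * sin (2 * kappa * x)
   - (r s - r t) / 4 * cos (2 * kappa * x).
  rewrite /trig_lift /q /r -/(p s) -/(p t) !addr0 !sinB; ring.
(* Each of the five terms of [E] will be at most [e / 8]. *)
have e8 : 0 < e / 8 by rewrite divr_gt0.
near=> s => x.
have ps : `|p s - p t| <= e / 8.
  by rewrite distrC ltW//; near: s; move/cvgrPdist_lt : (cp t); exact.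
have qs : `|q s - q t| <= e / 8.
  by rewrite distrC ltW//; near: s; move/cvgrPdist_lt : (cq t); exact.
have rs : `|r s - r t| <= e / 8.
  by rewrite distrC ltW//; near: s; move/cvgrPdist_lt : (cr t); exact.
have B (u v : R) : `|u| <= e / 8 -> `|v| <= 1 -> `|u * v| <= e / 8.
  by move=> ue v1; rewrite normrM -[leRHS]mulr1 ler_pM.
have B4 (u v : R) : `|u| <= e / 8 -> `|v| <= 1 -> `|u / 4 * v| <= e / 8.
  move=> ue; apply: B; rewrite normrM (le_trans _ ue)//.
  by rewrite ler_piMr// ger0_norm ?invr_ge0// invf_le1// ler1n.
rewrite E.
have h1 := B _ _ ps (sin_max (kappa * x)).
have h2 := B _ _ qs (sin_max (kappa * x)).
have h3 := B _ _ rs (cos_max (kappa * x)).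
have h4 := B4 _ _ qs (sin_max (2 * kappa * x)).
have h5 := B4 _ _ rs (cos_max (2 * kappa * x)).
move: h1 h2 h3 h4 h5; rewrite mulNr !ler_norml.
move: (_ * sin _) (_ * sin _) (_ * cos _) (_ * sin _) (_ * cos _) => a b c d f.
move=> /andP[? ?] /andP[? ?] /andP[? ?] /andP[? ?] /andP[? ?].
by apply/andP; split; lra.
Unshelve. all: by end_near. Qed.

End trig_family.

(** * Degree-one maps and semiconjugacies *)

Section dense_orbit.
Context {R : realType}.

Lemma ex_multiple_above (c e : R) : 0 <= c -> 0 < e ->
  exists j : nat, c < j%:R * e <= c + e.
Proof.
move=> c0 e0; have /andP[l u] := truncn_itv (divr_ge0 c0 (ltW e0)).
exists (Num.truncn (c / e)).+1; rewrite -ltr_pdivrMr// u/= -natr1 mulrDl mul1r.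
by rewrite lerD2r -ler_pdivlMr.
Qed.

(** Dirichlet's pigeonhole: among [N + 1] fractional parts of multiples of [rho], two share one of
    [N] boxes of length [1 / N < e]. Irrationality makes them distinct. *)
Lemma irrational_small_step (rho e : R) : irrational rho -> 0 < e ->
  exists (n : nat) (m : int), 0 < `|n%:R * rho + m%:~R| < e.
Proof.
move=> irr e0; have ei0 : 0 < e^-1 by rewrite invr_gt0.
have [N Ne] : exists N : nat, e^-1 < N%:R.
  by exists (Num.truncn e^-1).+1; have /andP[] := truncn_itv (ltW ei0).
have N0 : 0 < N%:R :> R by exact: lt_trans Ne.
pose fr (i : nat) : R := i%:R * rho - (Num.floor (i%:R * rho))%:~R.
have frP i : 0 <= fr i < 1.
  have := floor_itv (i%:R * rho); rewrite intrD => /andP[? ?].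
  by apply/andP; split; rewrite /fr; lra.
have tr i : (Num.truncn (N%:R * fr i) < N)%N.
  have /andP[f0 f1] := frP i.
  have /andP[l _] := truncn_itv (mulr_ge0 (ltW N0) f0).
  by rewrite -(ltr_nat R) (le_lt_trans l)// gtr_pMr.
pose g (i : 'I_N.+1) : 'I_N := Ordinal (tr i).
have /injectivePn[i [j ij gij]] : ~~ injectiveb g.
  by apply/injectiveP => /leq_card; rewrite !card_ord ltnn.
wlog lij : i j ij gij / (i < j)%N.
  move=> H; have := ij; rewrite -val_eqE neq_ltn => /orP[|] l; first exact: (H i j).
  by apply: (H j i) => //; rewrite eq_sym.
exists (j - i)%N, (Num.floor (i%:R * rho) - Num.floor (j%:R * rho)).
rewrite natrB ?(ltnW lij)// intrB.
have E : (j%:R - i%:R) * rho + ((Num.floor (i%:R * rho))%:~R -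
    (Num.floor (j%:R * rho))%:~R) = fr j - fr i by rewrite /fr; ring.
apply/andP; split.
  rewrite normr_gt0; apply/eqP => E0; apply: irr; apply/rationalP.
  exists (Num.floor (j%:R * rho) - Num.floor (i%:R * rho)), (j - i)%N.
  have ji0 : (j - i)%:R != 0 :> R by rewrite pnatr_eq0 subn_eq0 -ltnNge.
  apply: (mulIf ji0); rewrite divfK// natrB ?(ltnW lij)// intrB.
  by apply/eqP; rewrite -subr_eq0; apply/eqP; rewrite -[RHS]E0; ring.
rewrite E; have [/andP[a0 _] /andP[b0 _]] := (frP i, frP j).
have /andP[l u] := truncn_itv (mulr_ge0 (ltW N0) a0).
have /andP[l' u'] := truncn_itv (mulr_ge0 (ltW N0) b0).
have /(congr1 val)/= tij := gij.
rewrite -tij -!natr1 in l u l' u'.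
rewrite -(ltr_pM2l N0) -{1}(ger0_norm (ltW N0)) -normrM mulrBr.
apply: (@lt_trans _ _ 1).
  by rewrite ltr_norml; apply/andP; split; lra.
by rewrite -ltr_pdivrMr// mul1r.
Qed.

(** Since [n] is nonnegative, the sign of the small step [d] cannot be chosen: a positive step
    climbs from an integer below [a], a negative one descends from an integer above [b]. *)
Lemma irrational_orbit_dense (rho a b : R) : irrational rho -> a < b ->
  exists (n : nat) (m : int), a < n%:R * rho + m%:~R < b.
Proof.
move=> irr ab; have ab0 : 0 < b - a by rewrite subr_gt0.
have [n [m]] := irrational_small_step irr ab0.
set d := n%:R * rho + m%:~R => /andP[d0 dab].
have [dp|dn] := ltP 0 d.
  rewrite gtr0_norm// in dab.
  have [|j /andP[j1 j2]] := @ex_multiple_above (a - (Num.floor a)%:~R) d _ dp.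
    by rewrite subr_ge0; case/andP: (floor_itv a).
  exists (j * n)%N, (Num.floor a + j%:Z * m).
  have -> : (j * n)%:R * rho + (Num.floor a + j%:Z * m)%:~R =
            (Num.floor a)%:~R + j%:R * d by rewrite /d intrD intrM natrM; ring.
  by apply/andP; split; lra.
have dn' : 0 < - d by rewrite oppr_gt0 lt_neqAle dn -normr_gt0 d0.
rewrite ler0_norm// in dab.
have [|j /andP[j1 j2]] := @ex_multiple_above ((Num.floor b + 1)%:~R - b) (- d) _ dn'.
  by rewrite subr_ge0 ltW//; case/andP: (floor_itv b).
exists (j * n)%N, (Num.floor b + 1 + j%:Z * m).
have -> : (j * n)%:R * rho + (Num.floor b + 1 + j%:Z * m)%:~R =
          (Num.floor b + 1)%:~R + j%:R * d.
  by rewrite /d !intrD intrM natrM; ring.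
by rewrite mulrN in j1 j2; apply/andP; split; lra.
Qed.

End dense_orbit.

(** * Displacements of degree-one maps and semiconjugacies to translations *)

Section degree1.
Context {R : realType}.
Implicit Types (F G : R -> R) (x y rho : R).

Definition degree1 F := forall x n, n \is a Num.int -> F (x + n) = F x + n.

Lemma iter_degree1 F n : degree1 F -> degree1 (iter n F).
Proof. by move=> F1 x m mi; elim: n => //= n ->; rewrite F1. Qed.

Lemma iter_nondecreasing F n : {homo F : x y / x <= y} ->
  {homo iter n F : x y / x <= y}.
Proof. by move=> Fi x y xy; elim: n => //= n IH; exact: Fi. Qed.

(** The displacement is 1-periodic, so [y] may be moved into [[x, x + 1[], where monotonicity bounds
    [F y] by [F x + 1]. *)
Lemma degree1_osc F x y : {homo F : x y / x <= y} -> degree1 F ->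
  F y - y <= F x - x + 1.
Proof.
move=> Fi F1; pose k : R := - (Num.floor (y - x))%:~R.
have ki : k \is a Num.int by rewrite rpredN intr_int.
have := floor_itv (y - x); rewrite intrD => /andP[l u].
have : F (y + k) <= F (x + 1) by apply: Fi; rewrite /k; lra.
by rewrite !F1// /k; lra.
Qed.

Lemma degree1_itv F x : {homo F : x y / x <= y} -> degree1 F ->
  F 0 - 1 <= F x - x <= F 0 + 1.
Proof.
move=> Fi F1; have := degree1_osc 0 x Fi F1; have := degree1_osc x 0 Fi F1.
by rewrite !subr0 => ? ?; apply/andP; split; lra.
Qed.

Lemma degree1_surjective F y : {homo F : x y / x <= y} -> degree1 F ->
  continuous F -> exists x, F x = y.
Proof.
move=> Fi F1 cF; have /andP[_ Fa] := degree1_itv (y - F 0 - 1) Fi F1.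
have /andP[Fb _] := degree1_itv (y - F 0 + 1) Fi F1.
have ab : y - F 0 - 1 <= y - F 0 + 1 by lra.
have [|x _ <-] := @IVT R F _ _ y ab (continuous_subspaceT cF); last by exists x.
rewrite min_l ?max_r; [|exact: Fi|exact: Fi].
by apply/andP; split; lra.
Qed.

(** Uniform version of having rotation number [rho]: it implies the limit with an error of order
    [1 / n], and bounds the sequences whose limsup is [semiconj]. *)
Definition bounded_displacement F rho :=
  forall n x, `|iter n F x - x - n%:R * rho| <= 1.

Lemma bounded_displacement_cvg F rho x : bounded_displacement F rho ->
  (fun n : nat => (iter n F x - x) / n%:R) @ \oo --> rho.
Proof.
move=> bF; apply/cvgrPdist_le => e e0; near=> n.
have n0 : 0 < n%:R :> R by rewrite ltr0n; near: n; exact: nbhs_infty_gt.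
rewrite distrC -(ler_pM2r n0) -[X in _ * X <= _](gtr0_norm n0) -normrM.
rewrite mulrBl divfK ?gt_eqF// (mulrC rho); apply: le_trans (bF n x) _.
rewrite mulrC -ler_pdivrMr// mul1r.
by near: n; exact: nbhs_infty_ger.
Unshelve. all: by end_near. Qed.

Lemma semiconj_iter F (P : R -> R) c n x :
  (forall x, P (F x) = P x + c) -> P (iter n F x) = P x + n%:R * c.
Proof.
move=> PF; elim: n => [|n IH]; first by rewrite mul0r addr0.
by rewrite /= PF IH -natr1; ring.
Qed.

(** [P] stays within bounded distance of the identity, so along an orbit [n * c] and [n * rho]
    remain within bounded distance of each other for all [n]. *)
Lemma semiconj_translation F rho (P : R -> R) c :
  bounded_displacement F rho -> {homo P : x y / x <= y} -> degree1 P ->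
  (forall x, P (F x) = P x + c) -> c = rho.
Proof.
move=> bF Pi P1 PF.
have B n : n%:R * `|c - rho| <= 3.
  have := bF n 0; have := degree1_itv (iter n F 0) Pi P1.
  rewrite (semiconj_iter n 0 PF) subr0 => /andP[? ?].
  rewrite ler_norml => /andP[? ?].
  rewrite -[n%:R]ger0_norm// -normrM ler_norml mulrBr.
  by apply/andP; split; lra.
apply/eqP; rewrite -subr_eq0 -normr_eq0 eq_le normr_ge0 andbT leNgt.
apply/negP => d0; have [j /andP[j1 _]] := @ex_multiple_above R 3 _ (ler0n _ 3) d0.
by have := B j; rewrite leNgt j1.
Qed.

Lemma semiconj_orbit F rho (P : R -> R) n (m : int) :
  degree1 P -> (forall x, P (F x) = P x + rho) ->
  P (iter n F 0 + m%:~R) = P 0 + (n%:R * rho + m%:~R).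
Proof.
by move=> P1 PF; rewrite P1 ?intr_int// (semiconj_iter n 0 PF); ring.
Qed.

(** Otherwise some [n * rho + m] separates the two values. It is the common value of [P - P 0] and
    [Q - Q 0] at one orbit point, and on either side of that point [x] contradicts the monotonicity
    of [P] or of [Q]. *)
Lemma semiconj_unique_le F rho (P Q : R -> R) x : irrational rho ->
  {homo P : x y / x <= y} -> degree1 P -> (forall x, P (F x) = P x + rho) ->
  {homo Q : x y / x <= y} -> degree1 Q -> (forall x, Q (F x) = Q x + rho) ->
  P x - P 0 <= Q x - Q 0.
Proof.
move=> irr Pi P1 PF Qi Q1 QF; rewrite leNgt; apply/negP => lt.
have [n [m /andP[l u]]] := irrational_orbit_dense irr lt.
have [xy|yx] := leP x (iter n F 0 + m%:~R).
  have := Pi _ _ xy; rewrite (semiconj_orbit n m P1 PF); lra.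
have := Qi _ _ (ltW yx); rewrite (semiconj_orbit n m Q1 QF); lra.
Qed.

Lemma semiconj_unique F rho (P Q : R -> R) x : irrational rho ->
  {homo P : x y / x <= y} -> degree1 P -> (forall x, P (F x) = P x + rho) ->
  {homo Q : x y / x <= y} -> degree1 Q -> (forall x, Q (F x) = Q x + rho) ->
  P x - P 0 = Q x - Q 0.
Proof.
move=> irr Pi P1 PF Qi Q1 QF; apply/eqP; rewrite eq_le.
by rewrite !(@semiconj_unique_le F rho).
Qed.

(** A monotone function with dense values cannot jump: [x] is enclosed between two orbit points [y]
    and [y'] at which [h] is within [e] of [h x]. *)
Lemma semiconj_continuous F rho (h : R -> R) : irrational rho ->
  {homo h : x y / x <= y} -> degree1 h -> (forall x, h (F x) = h x + rho) ->
  continuous h.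
Proof.
move=> irr hi h1 hF x; apply/cvgrPdist_lt => e e0.
have lt1 : h x - h 0 - e < h x - h 0 by lra.
have lt2 : h x - h 0 < h x - h 0 + e by lra.
have [n [m /andP[l u]]] := irrational_orbit_dense irr lt1.
have [n' [m' /andP[l' u']]] := irrational_orbit_dense irr lt2.
have := semiconj_orbit n m h1 hF; set y := iter n F 0 + _ => hy.
have := semiconj_orbit n' m' h1 hF; set y' := iter n' F 0 + _ => hy'.
have yx : y < x.
  by rewrite ltNge; apply/negP => /hi; rewrite hy; lra.
have xy' : x < y'.
  by rewrite ltNge; apply/negP => /hi; rewrite hy'; lra.
near=> z.
have /hi hyz : y <= z by apply: ltW; near: z; exact: lt_nbhsr.
have /hi hzy : z <= y' by apply: ltW; near: z; exact: lt_nbhsl.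
by rewrite ltr_norml; apply/andP; split; lra.
Unshelve. all: by end_near. Qed.

Definition eventual_bounds F rho x : set R :=
  [set c | exists N : nat, forall n, (N <= n)%N -> iter n F x - n%:R * rho <= c].

(* [limsup (F^n x - n rho)] *)
Definition semiconj F rho x := inf (eventual_bounds F rho x).

(** Both equivariances of [semiconj], under integers and under [F], amount to a translation of the
    set of eventual bounds. *)
Lemma inf_shift (A B : set R) d : has_inf A ->
  (forall c, A c <-> B (c + d)) -> inf B = inf A + d.
Proof.
move=> [[a Aa] [l lA]] AB.
have lB : lbound B (inf A + d).
  move=> b Bb; rewrite -lerBrDr; apply: ge_inf; first by exists l.
  by apply/AB; rewrite subrK.
apply/eqP; rewrite eq_le; apply/andP; split; last first.
  by apply: lb_le_inf => //; exists (a + d); exact/AB.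
rewrite -lerBlDr; apply: lb_le_inf; first by exists a.
move=> c Ac; rewrite lerBlDr; apply: ge_inf; last exact/AB.
by exists (inf A + d).
Qed.

Section semiconj_theory.
Variables (F : R -> R) (rho : R).
Hypotheses (Fi : {homo F : x y / x <= y}) (F1 : degree1 F).
Hypothesis bF : bounded_displacement F rho.

Lemma has_inf_eventual_bounds x : has_inf (eventual_bounds F rho x).
Proof.
split; [exists (x + 1)|exists (x - 1)].
  by exists 0%N => n _; have := bF n x; rewrite ler_norml => /andP[? ?]; lra.
move=> c [N /(_ N (leqnn _))].
by have := bF N x; rewrite ler_norml => /andP[? ?] ?; lra.
Qed.

Lemma semiconj_nondecreasing : {homo semiconj F rho : x y / x <= y}.
Proof.
move=> x y xy; apply: lb_le_inf; first by case: (has_inf_eventual_bounds y).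
move=> c [N yN]; apply: ge_inf; first by case: (has_inf_eventual_bounds x).
exists N => n /yN; apply: le_trans; rewrite lerD2r.
exact: iter_nondecreasing.
Qed.

Lemma semiconj_degree1 : degree1 (semiconj F rho).
Proof.
move=> x m mi; apply: inf_shift; first exact: has_inf_eventual_bounds.
move=> c; split=> -[N xN]; exists N => n /xN; rewrite (iter_degree1 n F1)//; lra.
Qed.

(** Passing from [x] to [F x] drops the first term of the sequence and adds [rho] to the others. A
    limsup does not see the dropped term, whereas a supremum would only give an inequality. *)
Lemma semiconj_eq x : semiconj F rho (F x) = semiconj F rho x + rho.
Proof.
apply: inf_shift; first exact: has_inf_eventual_bounds.
move=> c; split=> -[N xN].
  exists N => n Nn; have := xN n.+1 (leqW Nn).
  by rewrite iterSr -natr1; lra.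
exists N.+1 => -[//|n] Nn; have := xN n Nn.
by rewrite iterSr -natr1; lra.
Qed.

End semiconj_theory.
End degree1.

(** * Choice of the parameters *)

(** Uniformity of the closeness in [y] matters because the maps for [s] and [t] are compared at the
    point [iter n (Phi s) x], which itself moves with [s]. *)
Lemma iter_continuous_param {R : realType} (T : topologicalType)
    (Phi : T -> R -> R) (t : T) (n : nat) (x : R) :
  (forall e, 0 < e ->
    \forall s \near t, forall y, `|Phi s y - Phi t y| <= e) ->
  continuous (Phi t) ->
  {for t, continuous (fun s => iter n (Phi s) x)}.
Proof.
move=> uPhi cPhi; elim: n => [|n IH]; first exact: cvg_cst.
apply/cvgrPdist_le => e e0 /=; have e2 : 0 < e / 2 by rewrite divr_gt0.
near=> s; have H1 : `|Phi s (iter n (Phi s) x) - Phi t (iter n (Phi s) x)| <= e / 2.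
  have : forall y, `|Phi s y - Phi t y| <= e / 2.
    by near: s; exact: uPhi.
  exact.
have H2 : `|Phi t (iter n (Phi t) x) - Phi t (iter n (Phi s) x)| <= e / 2.
  near: s.
  have := @continuous_comp _ _ _ (fun s => iter n (Phi s) x) (Phi t) t IH (cPhi _).
  by move/cvgrPdist_le; apply.
rewrite distrC [e]splitr.
apply: le_trans (lerD H1 H2); rewrite [X in _ <= _ + X]distrC.
by apply: le_trans (ler_normD _ _); rewrite addrA subrK.
Unshelve. all: by end_near. Qed.

Section rotation_parameter.
Context {R : realType}.
Implicit Types (F G : R -> R) (rho w : R).

(** For a monotone continuous [G] of degree one, these are the [w] whose translate has rotation
    number at most [rho]. The [+ 1] is the oscillation permitted by [degree1_osc]; phrasing by
    iterates makes each condition closed in [w]. *)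
Definition translates_below G rho : set R :=
  [set w | forall n x, iter n (fun y => G y + w) x - x <= n%:R * rho + 1].

Definition rotation_param G rho := sup (translates_below G rho).

Lemma iter_translate_continuous G n x : continuous G ->
  continuous (fun w => iter n (fun y => G y + w) x).
Proof.
move=> cG w; apply: (@iter_continuous_param R R (fun w y => G y + w)).
  move=> e e0; near=> v => y.
  rewrite opprD addrACA subrr add0r distrC.
  by near: v; have /cvgrPdist_le := @cvg_id _ (nbhs w); exact.
by move=> y; apply: cvgD; [exact: cG|exact: cvg_cst].
Unshelve. all: by end_near. Qed.

Lemma iter_le F G n x : {homo F : x y / x <= y} -> (forall y, F y <= G y) ->
  iter n F x <= iter n G x.
Proof.
by move=> Fi FG; elim: n => //= n IH; apply: le_trans (FG _); exact: Fi.
Qed.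

Section one_map.
Variables (G : R -> R) (rho : R).
Hypotheses (Gi : {homo G : x y / x <= y}) (G1 : degree1 G) (cG : continuous G).

Let Gw w : {homo (fun y => G y + w) : x y / x <= y}.
Proof. by move=> x y xy; rewrite lerD2r Gi. Qed.

Let Gw1 w : degree1 (fun y => G y + w).
Proof. by move=> x n ni; rewrite G1// addrAC. Qed.

Lemma has_sup_translates_below : has_sup (translates_below G rho).
Proof.
(* Displacements of [G] are at most [G 0 + 1], so this translate moves every point by at most [rho].
   The upper bound comes from [n = 1] at the point 0. *)
split; [exists (rho - (G 0 + 1))|exists (rho + 1 - G 0 + 1)].
  move=> n x; suff : iter n (fun y => G y + (rho - (G 0 + 1))) x <= x + n%:R * rho by lra.
  elim: n => [|n IH]; first by rewrite mul0r addr0.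
  have /andP[_] := degree1_itv (iter n (fun y => G y + (rho - (G 0 + 1))) x) Gi G1.
  by rewrite /= -natr1; lra.
move=> w /(_ 1%N 0); rewrite /=.
by rewrite mul1r; lra.
Qed.

(** The supremum is attained: a strict violation at some [n] and [x] would persist for admissible
    [w] close to it. *)
Lemma rotation_param_below : translates_below G rho (rotation_param G rho).
Proof.
move=> n x; rewrite leNgt; apply/negP => lt.
have : \forall w \near rotation_param G rho,
    n%:R * rho + 1 + x < iter n (fun y => G y + w) x.
  apply: (cvgr_gt _ (@iter_translate_continuous G n x cG _)); lra.
move=> /nbhs_ballP[e /= e0 eH].
have [w Sw wlt] := sup_adherent e0 has_sup_translates_below.
have := Sw n x; have : w <= rotation_param G rho.
  by apply: ub_le_sup => //; case: has_sup_translates_below.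
move=> wle; have := eH w; rewrite /ball/= ger0_norm ?subr_ge0//.
by rewrite ltrBlDr addrC -ltrBlDr => /(_ wlt); lra.
Qed.

(** If it failed, it would still fail for some [w] slightly above the parameter. By [degree1_osc],
    the [n]-th iterate would then move every point by at most [n * rho]. By maximality [w] is not
    admissible, so some [m]-th iterate moves every point by more than [m * rho]. The iterate of
    order [m * n] contradicts one of the two. *)
Lemma rotation_param_above n x :
  n%:R * rho - 1 <= iter n (fun y => G y + rotation_param G rho) x - x.
Proof.
rewrite leNgt; apply/negP => lt; set w0 := rotation_param G rho in lt *.
have : \forall w \near w0, iter n (fun y => G y + w) x < n%:R * rho - 1 + x.
  apply: (cvgr_lt _ (@iter_translate_continuous G n x cG _)); lra.
move=> /nbhs_ballP[e /= e0 eH]; pose w := w0 + e / 2.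
have w0w : w0 < w by rewrite ltrDl divr_gt0.
have below y : iter n (fun y => G y + w) y <= y + n%:R * rho.
  have := eH w; rewrite /ball/= distrC addrC addKr ger0_norm ?divr_ge0 ?(ltW e0)//.
  rewrite ltr_pdivrMr// ltr_pMr// ltr1n => /(_ isT) H.
  have := degree1_osc x y (iter_nondecreasing n (Gw w)) (iter_degree1 n (Gw1 w)).
  by lra.
have n0 : (0 < n)%N.
  by case: n lt below {eH} => //=; rewrite mul0r subrr; lra.
have : ~ translates_below G rho w.
  move=> Sw; have : w <= w0 by apply: ub_le_sup => //; case: has_sup_translates_below.
  by rewrite leNgt w0w.
move=> /existsNP[m /existsNP[z /negP]]; rewrite -ltNge => mz.
have above y : y + m%:R * rho < iter m (fun y => G y + w) y.
  have := degree1_osc y z (iter_nondecreasing m (Gw w)) (iter_degree1 m (Gw1 w)).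
  by lra.
have b k : iter (k * n) (fun y => G y + w) 0 <= (k * n)%:R * rho.
  elim: k => [|k IH]; first by rewrite mul0r.
  rewrite mulSn iterD; apply: le_trans (below _) _.
  by rewrite natrD mulrDl addrC lerD2l.
have a k : (k.+1 * m)%:R * rho < iter (k.+1 * m) (fun y => G y + w) 0.
  elim: k => [|k IH]; first by have := above 0; rewrite mul1n add0r.
  rewrite mulSn iterD; apply: lt_trans (above _).
  by rewrite natrD mulrDl addrC ltrD2r.
by have := a n.-1; rewrite (prednK n0) mulnC ltNge b.
Qed.

Lemma bounded_displacement_rotation_param :
  bounded_displacement (fun y => G y + rotation_param G rho) rho.
Proof.
move=> n x; rewrite ler_norml; apply/andP; split.
  by have := rotation_param_above n x; lra.
by have := rotation_param_below n x; lra.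
Qed.

End one_map.

(** When [w] is admissible for [G1], the map [G2 + (w - e)] lies below [G1 + w], so [w - e] is
    admissible for [G2]. Used in both directions, this makes the parameter 1-Lipschitz for the
    uniform distance. *)
Lemma rotation_param_le G1 G2 rho e : {homo G1 : x y / x <= y} ->
  {homo G2 : x y / x <= y} -> degree1 G1 -> degree1 G2 ->
  (forall x, G2 x - G1 x <= e) ->
  rotation_param G1 rho <= rotation_param G2 rho + e.
Proof.
move=> G1i G2i G11 G21 eG.
apply: ge_sup; first by case: (has_sup_translates_below rho G1i G11).
move=> w Sw; rewrite -lerBlDr; apply: ub_le_sup.
  by case: (has_sup_translates_below rho G2i G21).
move=> n x; apply: le_trans (Sw n x); rewrite lerD2r; apply: iter_le.
  by move=> y z yz; rewrite lerD2r G2i.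
by move=> y; have := eG y; lra.
Qed.

End rotation_parameter.

(** * Position of the second critical point *)

Section marked_point.
Context {R : realType}.
Variables (rho alpha : R).
Hypotheses (irr : irrational rho) (alpha01 : 0 < alpha < 1).

Definition trig_map (t x : R) : R :=
  trig_lift t x + rotation_param (trig_lift t) rho.

Lemma trig_map_lt t : {homo trig_map t : x y / x < y}.
Proof. by move=> x y xy; rewrite ltrD2r trig_lift_lt. Qed.

Lemma trig_map_le t : {homo trig_map t : x y / x <= y}.
Proof. by move=> x y xy; rewrite lerD2r trig_lift_le. Qed.

Lemma trig_map_degree1 t : degree1 (trig_map t).
Proof. by move=> x n ni; rewrite /trig_map trig_liftD// addrAC. Qed.

Lemma trig_map_continuous t : continuous (trig_map t).
Proof.
by move=> x; apply: cvgD; [exact: trig_lift_continuous|exact: cvg_cst].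
Qed.

Lemma bounded_displacement_trig_map t : bounded_displacement (trig_map t) rho.
Proof.
apply: bounded_displacement_rotation_param.
- exact: trig_lift_le.
- by move=> x n; exact: trig_liftD.
- exact: trig_lift_continuous.
Qed.

Lemma trig_map_unif t e : 0 < e ->
  \forall s \near t, forall x, `|trig_map s x - trig_map t x| <= e.
Proof.
move=> e0; have e2 : 0 < e / 2 by rewrite divr_gt0.
have := trig_lift_unif t e2; apply: filterS => s H x.
have W : `|rotation_param (trig_lift s) rho - rotation_param (trig_lift t) rho|
    <= e / 2.
  have D u : degree1 (trig_lift u) by move=> y n; exact: trig_liftD.
  have P u v : (forall x, trig_lift v x - trig_lift u x <= e / 2) ->
      rotation_param (trig_lift u) rho <= rotation_param (trig_lift v) rho + e / 2.
    by apply: rotation_param_le => //; exact: trig_lift_le.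
  have [Hst Hts] : (forall x, trig_lift t x - trig_lift s x <= e / 2) /\
      (forall x, trig_lift s x - trig_lift t x <= e / 2).
    by split => y; have := H y; rewrite ler_norml => /andP[? ?]; lra.
  have := P _ _ Hst; have := P _ _ Hts.
  by rewrite ler_norml => ? ?; apply/andP; split; lra.
rewrite [e]splitr; apply: le_trans (lerD (H x) W).
by apply: le_trans (ler_normD _ _); rewrite /trig_map opprD addrACA.
Qed.

Lemma trig_map_iter_continuous n x :
  continuous (fun t => iter n (trig_map t) x).
Proof.
move=> t; apply: (@iter_continuous_param R R trig_map).
  exact: trig_map_unif.
exact: trig_map_continuous.
Qed.

Let h t := semiconj (trig_map t) rho.

Let hi t : {homo h t : x y / x <= y}.
Proof.
apply: semiconj_nondecreasing; [exact: trig_map_le|].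
exact: bounded_displacement_trig_map.
Qed.

Let h1 t : degree1 (h t).
Proof.
apply: semiconj_degree1; [exact: trig_map_degree1|].
exact: bounded_displacement_trig_map.
Qed.

Let hF t x : h t (trig_map t x) = h t x + rho.
Proof. by apply: semiconj_eq; exact: bounded_displacement_trig_map. Qed.

Let horb t n (m : int) :
  h t (iter n (trig_map t) 0 + m%:~R) = h t 0 + (n%:R * rho + m%:~R).
Proof. exact: semiconj_orbit. Qed.

Let orbit_gap_continuous n (m : int) :
  continuous (fun t => iter n (trig_map t) 0 + m%:~R - t).
Proof.
move=> t; apply: cvgB; last exact: cvg_id.
by apply: cvgD; [exact: trig_map_iter_continuous|exact: cvg_cst].
Qed.

(* Strict inequalities between [h t t - h t 0] and [alpha] are witnessed by a
   single orbit point of [0], hence open in [t]. *)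
Lemma marked_gt_open : open [set t | alpha < h t t - h t 0].
Proof.
rewrite openE => t /= at_.
have [n [m /andP[l u]]] := irrational_orbit_dense irr at_.
have lt : iter n (trig_map t) 0 + m%:~R < t.
  by rewrite ltNge; apply/negP => /(@hi t); rewrite horb; lra.
(* The excess of [h s] at this orbit point over [h s 0] is [n * rho + m] for every [s]; only the
   position of the point depends on [s], and continuously. *)
have : \forall s \near t, iter n (trig_map s) 0 + m%:~R - s < 0.
  by apply: (cvgr_lt _ (@orbit_gap_continuous n m t)); lra.
rewrite /interior/=; apply: filterS => s; rewrite subr_lt0 => /ltW/(@hi s).
by rewrite horb /=; lra.
Qed.

Lemma marked_lt_open : open [set t | h t t - h t 0 < alpha].
Proof.
rewrite openE => t /= at_.
have [n [m /andP[l u]]] := irrational_orbit_dense irr at_.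
have lt : t < iter n (trig_map t) 0 + m%:~R.
  by rewrite ltNge; apply/negP => /(@hi t); rewrite horb; lra.
have : \forall s \near t, iter n (trig_map s) 0 + m%:~R - s > 0.
  by apply: (cvgr_gt _ (@orbit_gap_continuous n m t)); lra.
rewrite /interior/=; apply: filterS => s; rewrite subr_gt0 => /ltW/(@hi s).
by rewrite horb /=; lra.
Qed.

Lemma ex_marked_eq : exists t, 0 < t < 1 /\ h t t - h t 0 = alpha.
Proof.
have [a0 a1] := andP alpha01.
have h10 t : h t 1 = h t 0 + 1 by rewrite -[X in h t X]add0r h1// rpred1.
have [t ht] : exists t, h t t - h t 0 = alpha.
  apply: contrapT => nt.
  pose A := [set t | alpha < h t t - h t 0].
  have AC : ~` A = [set t | h t t - h t 0 < alpha].
    apply/seteqP; split => t /=; last by move=> lt1; apply/negP; rewrite -leNgt ltW.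
    move=> /negP; rewrite -leNgt le_eqVlt => /predU1P[E|//].
    by exfalso; apply: nt; exists t.
  have cT : connected [set: R] by apply/connected_intervalP.
  have : A = setT.
    apply: cT.
    - by exists 1; rewrite /A/= h10; lra.
    - by exists A; [exact: marked_gt_open|rewrite setTI].
    - exists A; last by rewrite setTI.
      by rewrite -[A]setCK; apply: open_closedC; rewrite AC; exact: marked_lt_open.
  move/seteqP => [_ /(_ 0 Logic.I)]; rewrite /A/= subrr; lra.
(* Monotonicity of [h t] locates [t]: the difference would be at most 0 for [t <= 0] and at least 1
   for [t >= 1]. *)
exists t; split => //; apply/andP; split; rewrite ltNge; apply/negP.
  by move=> /(@hi t); lra.
by move=> /(@hi t); rewrite h10; lra.
Qed.

End marked_point.

(** * The circle and its maps *)

Section circle_theory.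
Context {R : realType}.
Implicit Types (F : R -> R) (f : circle R -> circle R) (x y t : R) (u : circle R).

Lemma circle_piP x y : circle_pi x = circle_pi y <-> x - y \is a Num.int.
Proof. by split => [/eqmodP//|?]; apply/eqmodP. Qed.

Lemma circle_pi_continuous : continuous (@circle_pi R).
Proof. exact: pi_continuous. Qed.

Lemma circle_piD x n : n \is a Num.int -> circle_pi (x + n) = circle_pi x.
Proof. by move=> ni; apply/circle_piP; rewrite addrAC subrr add0r. Qed.

(** [repr] is an arbitrary representative; reducing it to [[0, 1[] makes the section explicit, hence
    Borel measurable. *)
Definition circle_sec u : R :=
  let x := repr (u : {eq_quot (@congr_mod1 R)}%qT) in x - (Num.floor x)%:~R.

Lemma circle_secK : cancel circle_sec (@circle_pi R).
Proof.
move=> u; rewrite /circle_sec circle_piD ?rpredN ?intr_int//.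
exact: reprK.
Qed.

Lemma circle_sec_itv u : 0 <= circle_sec u < 1.
Proof.
have := floor_itv (repr (u : {eq_quot (@congr_mod1 R)}%qT)).
by rewrite intrD /circle_sec => /andP[? ?]; apply/andP; split; lra.
Qed.

Lemma circle_piK x : 0 <= x < 1 -> circle_sec (circle_pi x) = x.
Proof.
move=> /andP[x0 x1]; have /andP[s0 s1] := circle_sec_itv (circle_pi x).
have /circle_piP xs := circle_secK (circle_pi x).
have [lt|lt|//] := ltgtP (circle_sec (circle_pi x)) x.
  by have := @int_dist_lt1 R _ 0 xs (rpred0 _); lra.
by have := @int_dist_lt1 R 0 _ (rpred0 _) xs; lra.
Qed.

Lemma circle_continuous (T : topologicalType) (f : circle R -> T) :
  continuous (f \o @circle_pi R) -> continuous f.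
Proof. by move=> cf; apply/quotient_continuous. Qed.

Lemma circle_openP (A : set (circle R)) :
  open A <-> open (@circle_pi R @^-1` A).
Proof. by []. Qed.

Definition circle_map F u : circle R := circle_pi (F (circle_sec u)).

Lemma circle_mapE F x : degree1 F -> circle_map F (circle_pi x) = circle_pi (F x).
Proof.
move=> F1; have /circle_piP/F1 E := circle_secK (circle_pi x).
apply/circle_piP; have := E x; rewrite addrC subrK => ->.
by rewrite addrAC subrr add0r; apply/circle_piP; exact: circle_secK.
Qed.

Lemma is_lift_circle_map F : continuous F -> degree1 F -> is_lift (circle_map F) F.
Proof. by move=> cF F1; split => // x; rewrite circle_mapE. Qed.

Lemma circle_map_continuous F : continuous F -> degree1 F -> continuous (circle_map F).
Proof.
move=> cF F1; apply: circle_continuous.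
rewrite (_ : _ \o _ = @circle_pi R \o F); last first.
  by apply/funext => x; rewrite /= circle_mapE.
by move=> x; apply: continuous_comp; [exact: cF|exact: circle_pi_continuous].
Qed.

(** The difference of two lifts is continuous and integer valued, hence locally constant. So
    criticality can be tested on any one lift. *)
Lemma lift_locally_unique f F F' x : is_lift f F -> is_lift f F' ->
  \forall y \near x, F' x + (F y - F x) = F' y.
Proof.
move=> [cF lF] [cF' lF'].
have cD : {for x, continuous (fun y => F' y - F y)} by apply: cvgB; [exact: cF'|exact: cF].
have := cD; move/cvgrPdist_lt => /(_ 1 ltr01); apply: filterS => y /=.
have I z : F' z - F z \is a Num.int by apply/circle_piP; rewrite lF lF'.
rewrite ltr_norml => /andP[l u].
have [lt|lt|E] := ltgtP (F' x - F x) (F' y - F y); last by lra.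
  by have := int_dist_lt1 (I x) (I y) lt; lra.
by have := int_dist_lt1 (I y) (I x) lt; lra.
Qed.

Lemma critical_pointE f F : is_lift f F ->
  critical_point f = [set c | exists x, circle_pi x = c /\ is_derive x 1 F 0].
Proof.
move=> lF; apply/seteqP; split => c; last first.
  by move=> [x [xc dF]]; exists F, x.
move=> [F' [x [lF' xc dF']]]; exists x; split => //.
apply: near_eq_is_derive (lift_locally_unique x lF' lF) _.
have := is_deriveD (is_derive_cst (F x) x 1)
  (is_deriveB dF' (is_derive_cst (F' x) x 1)).
by rewrite subr0 addr0.
Qed.

Section increasing_lift.
Variable F : R -> R.
Hypotheses (Flt : {homo F : x y / x < y}) (F1 : degree1 F) (cF : continuous F).

Lemma lift_le_mono : {mono F : x y / x <= y}.
Proof. exact: le_mono. Qed.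

Definition lift_inv y : R := xget 0 [set x | F x = y].

Lemma lift_invK : cancel lift_inv F.
Proof.
move=> y; rewrite /lift_inv; case: xgetP => [x _ //|/=].
by have [x Fx] := degree1_surjective y (ltW_homo Flt) F1 cF => /(_ x).
Qed.

Lemma liftK : cancel F lift_inv.
Proof.
by move=> x; apply: (inc_inj lift_le_mono); exact: lift_invK.
Qed.

Lemma lift_inv_degree1 : degree1 lift_inv.
Proof.
move=> x n ni; rewrite -[RHS]liftK; congr lift_inv.
by rewrite F1// lift_invK.
Qed.

Lemma lift_inv_continuous : continuous lift_inv.
Proof.
move=> y; apply/cvgrPdist_lt => e e0.
have l : F (lift_inv y - e) < y by rewrite -{2}(lift_invK y) Flt//; lra.
have u : y < F (lift_inv y + e) by rewrite -{1}(lift_invK y) Flt//; lra.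
near=> z; have lz : F (lift_inv y - e) < z by near: z; exact: lt_nbhsr.
have zu : z < F (lift_inv y + e) by near: z; exact: lt_nbhsl.
have lz' : lift_inv y - e < lift_inv z.
  by rewrite ltNge -lift_le_mono lift_invK -ltNge.
have zu' : lift_inv z < lift_inv y + e.
  by rewrite ltNge -lift_le_mono lift_invK -ltNge.
by rewrite ltr_norml; apply/andP; split; lra.
Unshelve. all: by end_near. Qed.

Lemma circle_map_homeomorphism : homeomorphism (circle_map F).
Proof.
split; first exact: circle_map_continuous.
have I1 := lift_inv_degree1.
exists (circle_map lift_inv); split.
- exact: circle_map_continuous lift_inv_continuous I1.
- by move=> u; rewrite -(circle_secK u) !circle_mapE// liftK.
- by move=> u; rewrite -(circle_secK u) !circle_mapE// lift_invK.
Qed.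

End increasing_lift.

Lemma circle_pi_arc a b x :
  (circle_pi @` `]a, b[) (circle_pi x) <->
  exists n, n \is a Num.int /\ a < x + n < b.
Proof.
split=> [[y] /= + /circle_piP yx|[n [ni xn]]].
  by rewrite in_itv/= => yab; exists (y - x); split => //; rewrite addrC subrK.
by exists (x + n); rewrite ?circle_piD.
Qed.

Lemma open_circle_arc a b : open (@circle_pi R @` `]a, b[).
Proof.
apply/circle_openP; rewrite openE => x /circle_pi_arc[n [ni /andP[l u]]].
rewrite /interior/=; near=> y; apply/circle_pi_arc; exists n; split => //.
apply/andP; split; [rewrite -ltrBlDr|rewrite -ltrBrDr].
  by near: y; apply: lt_nbhsr; rewrite ltrBlDr.
by near: y; apply: lt_nbhsl; rewrite ltrBrDr.
Unshelve. all: by end_near. Qed.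

Lemma connected_circle_arc a b : connected (@circle_pi R @` `]a, b[).
Proof.
apply: connected_continuous_connected.
  by apply/connected_intervalP; exact: interval_is_interval.
exact: continuous_subspaceT circle_pi_continuous.
Qed.

Lemma circle_arcs_cover t : 0 < t < 1 ->
  ~` [set circle_pi 0; circle_pi t] =
  (@circle_pi R @` `]0, t[) `|` (@circle_pi R @` `]t, 1[).
Proof.
move=> /andP[t0 t1]; apply/seteqP; split => u.
  rewrite -(circle_secK u); move: (circle_sec_itv u).
  move: (circle_sec u) => x /andP[x0 x1] /= /not_orP[n0 nt].
  have [xt|xt|E] := ltgtP x t; last by rewrite E in nt.
    left; exists x => //; rewrite /= in_itv/= xt andbT lt_neqAle x0 andbT.
    by apply/eqP => E; rewrite -E in n0.
  by right; exists x => //; rewrite /= in_itv/= xt.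
(* In all four cases the integer [n] would lie strictly between two consecutive integers. *)
move=> H [] uE; move: H; rewrite uE => -[] /circle_pi_arc[n [ni /andP[l r]]];
  by [apply: (@int_dist_lt1 R 0 n); rewrite ?rpred0//; lra
     |apply: (@int_dist_lt1 R n 1); rewrite ?rpred1//; lra
     |apply: (@int_dist_lt1 R n 0); rewrite ?rpred0//; lra
     |apply: (@int_dist_lt1 R 0 n); rewrite ?rpred0//; lra].
Qed.

Lemma circle_arcs_disjoint t : 0 < t < 1 ->
  (@circle_pi R @` `]0, t[) `&` (@circle_pi R @` `]t, 1[) = set0.
Proof.
move=> /andP[t0 t1]; apply/seteqP; split => // _ [[x + <-]].
rewrite /= in_itv/= => /andP[x0 xt] /circle_pi_arc[n [ni /andP[l r]]].
have [n0|n0] := leP n 0.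
  move: n0; rewrite le_eqVlt => /predU1P[n0|n0]; first by move: l; rewrite n0; lra.
  by apply: (@int_dist_lt1 R n 0); rewrite ?rpred0//; lra.
by apply: (@int_dist_lt1 R 0 n); rewrite ?rpred0//; lra.
Qed.

(** Inside the component of [x], the set [A] is open and, as the trace of the complement of [B],
    closed; by connectedness it fills the component. *)
Lemma connected_component_open_split (T : topologicalType) (U A B : set T) (x : T) :
  open A -> open B -> connected A -> U = A `|` B -> A `&` B = set0 -> A x ->
  connected_component U x = A.
Proof.
move=> oA oB cA UAB AB Ax; apply/seteqP; split; last first.
  by apply: connected_component_max => //; rewrite UAB; exact: subsetUl.
have cC := @component_connected T U x.
have CU : connected_component U x `<=` A `|` B.
  by rewrite -UAB; exact: connected_component_sub.
have Cx : connected_component U x x.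
  by apply: connected_component_refl; rewrite UAB; left.
have : connected_component U x `&` A = connected_component U x.
  apply: cC.
  - by exists x.
  - by exists A.
  - exists (~` B); first exact: open_closedC.
    apply/seteqP; split => z [Cz]; last by case: (CU _ Cz).
    move=> Az; split => // Bz.
    by have : (A `&` B) z by []; rewrite AB.
by move=> <- z [].
Qed.

Lemma components_circle_arcs t : 0 < t < 1 ->
  components (~` [set circle_pi 0; circle_pi t]) =
  [set @circle_pi R @` `]0, t[; @circle_pi R @` `]t, 1[].
Proof.
move=> t01; have UAB := circle_arcs_cover t01; have AB := circle_arcs_disjoint t01.
have [t0 t1] := andP t01.
set A := (_ @` `]0, t[) in UAB AB *; set B := (_ @` `]t, 1[) in UAB AB *.
have oA : open A by exact: open_circle_arc.
have oB : open B by exact: open_circle_arc.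
have cA (x : circle R) : A x -> connected_component (~` [set circle_pi 0; circle_pi t]) x = A.
  apply: connected_component_open_split UAB AB => //.
  exact: connected_circle_arc.
have cB (x : circle R) : B x -> connected_component (~` [set circle_pi 0; circle_pi t]) x = B.
  rewrite [RHS]setUC in UAB; rewrite setIC in AB.
  apply: connected_component_open_split UAB AB => //.
  exact: connected_circle_arc.
apply/seteqP; split => [C [x Ux] <-|C].
  have : (A `|` B) x by rewrite -UAB.
  by move=> [Ax|Bx]; [left; exact: cA|right; exact: cB].
move=> [->|->].
  have Ax : A (circle_pi (t / 2)).
    by exists (t / 2) => //; rewrite /= in_itv/=; apply/andP; split; lra.
  by exists (circle_pi (t / 2)); [rewrite UAB; left|exact: cA].
have Bx : B (circle_pi ((t + 1) / 2)).
  by exists ((t + 1) / 2) => //; rewrite /= in_itv/=; apply/andP; split; lra.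
by exists (circle_pi ((t + 1) / 2)); [rewrite UAB; right|exact: cB].
Qed.

End circle_theory.

(** * Quasi-inverses and the rotation of Lebesgue measure *)

Section quasi_inverse.
Context {R : realType}.
Variable h : R -> R.
Hypotheses (hi : {homo h : x y / x <= y}) (h1 : degree1 h) (ch : continuous h).
Implicit Types x y : R.

(** Right end of the fibre of [h] over [y], which may be a nontrivial interval. *)
Definition quasi_inverse y := sup [set x | h x <= y].

(** A Galois connection, from which the other properties of the quasi-inverse are read off.
    Continuity of [h] makes the supremum attained. *)
Lemma quasi_inverse_le x y : (x <= quasi_inverse y) = (h x <= y).
Proof.
have hs : has_sup [set x | h x <= y].
  have [z hz] := degree1_surjective y hi h1 ch.
  split; first by exists z; rewrite /= hz.
  exists (y - h 0 + 1) => w /= hw.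
  by have /andP[? _] := degree1_itv w hi h1; lra.
have [ne ub] := hs.
apply/idP/idP => [xk|hxy]; last exact: ub_le_sup.
apply: le_trans (hi xk) _; rewrite leNgt; apply/negP => lt.
have /nbhs_ballP[e /= e0 eH] : \forall z \near quasi_inverse y, y < h z.
  by apply: (cvgr_gt _ (@ch _)); exact: lt.
have [w /= hw wlt] := sup_adherent e0 hs.
have wle : w <= quasi_inverse y by exact: ub_le_sup.
have := eH w; rewrite /ball/= ger0_norm ?subr_ge0//.
by rewrite ltrBlDr addrC -ltrBlDr => /(_ wlt); lra.
Qed.

Lemma eq_of_le_iff (a b : R) : (forall x, (x <= a) = (x <= b)) -> a = b.
Proof.
move=> E; apply/eqP; rewrite eq_le; have := E a; have := E b.
by rewrite !lexx => -> <-.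
Qed.

Lemma quasi_inverseK y : h (quasi_inverse y) = y.
Proof.
have [x hx] := degree1_surjective y hi h1 ch; apply/eqP; rewrite eq_le.
by rewrite -quasi_inverse_le lexx/= -{1}hx hi// quasi_inverse_le hx.
Qed.

Lemma quasi_inverse_nondecreasing : {homo quasi_inverse : x y / x <= y}.
Proof. by move=> x y xy; rewrite quasi_inverse_le quasi_inverseK. Qed.

Lemma quasi_inverse_degree1 : degree1 quasi_inverse.
Proof.
move=> y n ni; apply: eq_of_le_iff => x.
rewrite quasi_inverse_le -[RHS]lerBlDr quasi_inverse_le -[X in h X <= _](subrK n x).
by rewrite h1// lerD2r.
Qed.

Lemma quasi_inverse_semiconj F rho y : {homo F : x y / x < y} -> degree1 F ->
  continuous F -> (forall x, h (F x) = h x + rho) ->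
  quasi_inverse (y + rho) = F (quasi_inverse y).
Proof.
move=> Flt F1 cF hF; apply: eq_of_le_iff => x.
rewrite quasi_inverse_le -{1}(lift_invK Flt F1 cF x) hF lerD2r.
by rewrite -quasi_inverse_le -(lift_le_mono Flt) lift_invK.
Qed.

End quasi_inverse.

(** * Lebesgue measure modulo 1 *)

Section lebesgue_translation.
Context {R : realType}.
Local Notation leb := (@lebesgue_measure R).

Lemma lebesgue_measure_translation (c : R) (A : set (measurableTypeR R)) :
  measurable A -> leb ((fun x => x + c) @^-1` A) = leb A.
Proof.
have mc : measurable_fun [set: measurableTypeR R]
    ((fun x : R => x + c) : measurableTypeR R -> measurableTypeR R).
  by apply: nondecreasing_measurable => // x y xy; rewrite lerD2r.
move=> mA; rewrite -[LHS]/(pushforward leb ((fun x : R => x + c) : _ -> measurableTypeR R) A).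
apply/esym; apply: lebesgue_measure_unique => //.
move=> _ [[a b] _ <-].
rewrite -[RHS]/(leb ((fun x => x + c) @^-1` `]a, b])).
rewrite (_ : _ @^-1` _ = `]a - c, b - c]%classic); last first.
  by apply/seteqP; split => x; rewrite /= !in_itv/= ltrBlDr lerBrDr.
rewrite !lebesgue_measure_itv/= !lte_fin ltrD2r; case: ifP => // _.
by rewrite !EFinB; congr (_%:E); ring.
Qed.

(** Rotations preserve Lebesgue measure on the circle: the translated domain [[rho, 1 + rho[] is cut
    at 1, and periodicity brings its right piece back to [[0, rho[]. *)
Lemma lebesgue_periodic_translation (rho : R) (E : set (measurableTypeR R)) :
  0 <= rho <= 1 -> measurable E -> (forall x, E (x + 1) <-> E x) ->
  leb (((fun x => x + rho) @^-1` E) `&` `[0, 1[) = leb (E `&` `[0, 1[).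
Proof.
move=> /andP[r0 r1] mE E1.
have mI (a b : R) : measurable (E `&` `[a, b[) by exact: measurableI.
have -> : ((fun x => x + rho) @^-1` E) `&` `[0, 1[ =
    (fun x => x + rho) @^-1` (E `&` `[rho, 1 + rho[).
  apply/seteqP; split => x /=; rewrite !in_itv/=.
    by rewrite lerDr ltrD2r.
  by rewrite lerDr ltrD2r.
rewrite lebesgue_measure_translation//.
have split a b c : a <= b -> b <= c ->
    leb (E `&` `[a, c[) = (leb (E `&` `[a, b[) + leb (E `&` `[b, c[))%E.
  move=> ab bc; rewrite -measureU//.
    rewrite -setIUr; congr (leb (_ `&` _)).
    by rewrite -itv_bndbnd_setU// bnd_simp.
  apply/seteqP; split => x // [[_ /=]]; rewrite in_itv/= => /andP[_ xb] [_].
  by rewrite /= in_itv/= => /andP[bx _]; lra.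
rewrite (split rho 1 (1 + rho))//; last by lra.
rewrite (split 0 rho 1)// addeC; congr (_ + _)%E.
rewrite -(@lebesgue_measure_translation 1 (E `&` `[1, 1 + rho[))//.
congr (leb _); apply/seteqP; split => x /= [].
  by move/E1 => Ex; rewrite !in_itv/= => /andP[? ?]; split => //; apply/andP; split; lra.
by move=> /E1 Ex; rewrite !in_itv/= => /andP[? ?]; split => //; apply/andP; split; lra.
Qed.

Lemma uniform_probE (E : set (measurableTypeR R)) : measurable E ->
  uniform_prob (@ltr01 R) E = leb (E `&` `[0, 1[).
Proof.
move=> mE; rewrite /uniform_prob integral_uniform_pdf.
rewrite (eq_integral (cst 1%:E)); last first.
  move=> x; rewrite inE/= in_itv/= => -[_ x01].
  by rewrite /uniform_pdf x01 subr0 invr1.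
rewrite integral_cst ?mul1e; last exact: measurableI.
(* The uniform density lives on the closed interval; the half-open fundamental domain omits only a
   null point. *)
have -> : E `&` `[0, 1] = (E `&` `[0, 1[) `|` (E `&` [set 1]).
  rewrite -setIUr; congr (_ `&` _); apply/seteqP; split => x /=.
    by rewrite !in_itv/= => /andP[-> ]; rewrite le_eqVlt => /predU1P[->|->]; [right|left].
  by rewrite !in_itv/= => -[/andP[-> /ltW]//|->]; rewrite ler01 lexx.
rewrite measureU0//; [exact: measurableI|exact: measurableI|].
apply/eqP; rewrite eq_le measure_ge0 andbT.
rewrite -[leRHS](lebesgue_measure_set1 (1 : R)); apply: le_measure.
- by rewrite inE; exact: measurableI.
- by rewrite inE.
- exact: subIsetr.
Qed.

End lebesgue_translation.

(** * Invariant measures *)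

Section circle_measure.
Context {R : realType}.
Local Notation leb := (@lebesgue_measure R).

Lemma measurable_circle_pi :
  measurable_fun [set: measurableTypeR R]
    (@circle_pi R : measurableTypeR R -> circle_borel R).
Proof.
apply: (@measurability _ _ _ (circle_borel R) _ _ (@open (circle R))) => //.
move=> _ [A oA <-].
by rewrite setTI; exact: open_measurable.
Qed.

Lemma continuous_circle_measurable (f : circle R -> circle R) : continuous f ->
  measurable_fun [set: circle_borel R] (f : circle_borel R -> circle_borel R).
Proof.
move=> /continuousP cf.
apply: (@measurability _ _ _ (circle_borel R) _ _ (@open (circle R))) => //.
move=> _ [A oA <-].
by rewrite setTI; apply: sub_sigma_algebra; exact: cf.
Qed.

(** The section jumps at the class of 0, yet these level sets are open arcs, which is enough for
    measurability. *)
Lemma circle_sec_gt (x : R) : 0 <= x ->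
  (@circle_sec R) @^-1` `]x, +oo[ = @circle_pi R @` `]x, 1[.
Proof.
move=> x0; apply/seteqP; split => u /=.
  rewrite in_itv/= andbT => xu; exists (circle_sec u); last exact: circle_secK.
  by rewrite /= in_itv/= xu; case/andP: (circle_sec_itv u).
move=> [y + <-]; rewrite /= !in_itv/= andbT => /andP[xy y1].
by rewrite circle_piK// y1 andbT ltW// (le_lt_trans x0).
Qed.

Lemma measurable_circle_sec :
  measurable_fun [set: circle_borel R]
    (@circle_sec R : circle_borel R -> measurableTypeR R).
Proof.
apply: (measurability (@RGenOInfty.G R)); first exact: RGenOInfty.measurableE.
move=> _ [_ [x ->] <-]; rewrite setTI; have [x0|x0] := ltP x 0; last first.
  rewrite circle_sec_gt//; apply: sub_sigma_algebra; exact: open_circle_arc.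
rewrite (_ : _ @^-1` _ = setT)//; apply/seteqP; split => u //= _.
rewrite in_itv/= andbT (lt_le_trans x0)//.
by case/andP: (circle_sec_itv u).
Qed.

Lemma ex_distribution d d' (T : measurableType d) (T' : measurableType d')
    (P : probability T R) (f : T -> T') : measurable_fun setT f ->
  exists mu : probability T' R, forall A, mu A = P (f @^-1` A).
Proof.
by move=> mf; exists (distribution P (mfun_Sub (mem_set mf))).
Qed.

(** * Existence of an invariant measure *)

Section invariant_exists.
Variables (F h : R -> R) (rho : R).
Hypotheses (Flt : {homo F : x y / x < y}) (F1 : degree1 F) (cF : continuous F).
Hypotheses (hi : {homo h : x y / x <= y}) (h1 : degree1 h) (ch : continuous h).
Hypotheses (hF : forall x, h (F x) = h x + rho) (rho01 : 0 <= rho <= 1).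

Let k := quasi_inverse h.

Let mk : measurable_fun [set: measurableTypeR R]
  (@circle_pi R \o k : measurableTypeR R -> circle_borel R).
Proof.
apply: measurableT_comp; first exact: measurable_circle_pi.
apply: nondecreasing_measurable => // x y.
exact: quasi_inverse_nondecreasing.
Qed.

Lemma ex_invariant_measure : exists mu : probability (circle_borel R) R,
  Defs.invariant (circle_map F) mu /\
  forall A : set (circle_borel R), measurable A ->
    mu A = leb ((@circle_pi R \o k) @^-1` A `&` `[0, 1[).
Proof.
have [mu muE] := ex_distribution (uniform_prob (@ltr01 R)) mk.
have mE (A : set (circle_borel R)) : measurable A ->
    measurable ((@circle_pi R \o k : measurableTypeR R -> circle_borel R) @^-1` A).
  by move=> mA; rewrite -[X in measurable X]setTI; exact: mk.
have muE' (A : set (circle_borel R)) : measurable A ->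
    mu A = leb ((@circle_pi R \o k) @^-1` A `&` `[0, 1[).
  by move=> mA; exact: etrans (muE A) (uniform_probE (mE A mA)).
exists mu; split => // A mA.
have mfA : measurable ((circle_map F : circle_borel R -> circle_borel R) @^-1` A).
  rewrite -[X in measurable X]setTI.
  exact: continuous_circle_measurable (circle_map_continuous cF F1) _ _ mA.
rewrite !muE'//.
(* [k] turns the translation by [rho] into [F], so invariance under [F] becomes invariance of
   Lebesgue measure on a 1-periodic set. *)
rewrite -[RHS](@lebesgue_periodic_translation R rho)//; last 2 first.
- exact: mE.
- by move=> y; rewrite /= /k quasi_inverse_degree1// ?rpred1// circle_piD// rpred1.
congr (leb (_ `&` _)); apply/seteqP; split => y /=.
  by rewrite circle_mapE// /k (quasi_inverse_semiconj hi h1 ch _ Flt F1 cF hF).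
by rewrite circle_mapE// /k (quasi_inverse_semiconj hi h1 ch _ Flt F1 cF hF).
Qed.

End invariant_exists.

(** * Uniqueness of the invariant measure *)

Section invariant_unique.
Variables (F : R -> R) (rho : R).
Hypotheses (Flt : {homo F : x y / x < y}) (F1 : degree1 F) (cF : continuous F).
Hypotheses (bF : bounded_displacement F rho) (irr : irrational rho).

(* Counts lifts of [u] in an interval: its integral against an invariant measure
   is a distribution function that [F] translates by a constant. *)
Definition count_below (x : R) (u : circle_borel R) : R :=
  (Num.floor (x - circle_sec u))%:~R.

Lemma measurable_count_below x : measurable_fun setT (count_below x).
Proof.
apply: (@measurableT_comp _ _ _ _ _ _ (fun y : R => (Num.floor y)%:~R : R)
   _ (fun u : circle_borel R => x - circle_sec u)).
  by apply: nondecreasing_measurable => // y z yz; rewrite ler_int le_floor.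
by apply: measurable_funB => //; exact: measurable_circle_sec.
Qed.

Lemma count_below_norm x u : `|count_below x u| <= `|x| + 2.
Proof.
have /andP[s0 s1] := circle_sec_itv u.
have := floor_itv (x - circle_sec u); rewrite intrD -/(count_below x u).
move=> /andP[l r]; have := ler_norm x; have := ler_norm (- x); rewrite normrN.
by move=> ? ?; rewrite ler_norml; apply/andP; split; lra.
Qed.

Lemma integrable_bounded (nu : probability (circle_borel R) R)
    (f : circle_borel R -> R) (C : R) : measurable_fun setT f ->
  (forall u, `|f u| <= C) -> nu.-integrable setT (EFin \o f).
Proof.
move=> mf fC; apply: measurable_bounded_integrable => //.
  exact: le_lt_trans (probability_le1 nu measurableT) (ltry _).
exists C; split; first exact: num_real.
by move=> M CM u _; exact: le_trans (fC u) (ltW CM).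
Qed.

Lemma integrable_count_below (nu : probability (circle_borel R) R) x :
  nu.-integrable setT (EFin \o count_below x).
Proof.
exact: integrable_bounded (measurable_count_below x) (count_below_norm x).
Qed.

Definition circle_cdf (nu : probability (circle_borel R) R) (x : R) : R :=
  \int[nu]_u count_below x u.

Lemma circle_cdf_nondecreasing nu : {homo circle_cdf nu : x y / x <= y}.
Proof.
move=> x y xy; apply: le_Rintegral => //; try exact: integrable_count_below.
by move=> u _; rewrite ler_int; apply: le_floor; rewrite lerD2r.
Qed.

Lemma count_belowD x n u : n \is a Num.int ->
  count_below (x + n) u = count_below x u + n.
Proof.
move=> /intrP[m ->]; rewrite /count_below -intrD; congr (_%:~R).
by rewrite addrAC floorDrz ?intr_int// intrKfloor.
Qed.

Lemma circle_cdf_degree1 nu : degree1 (circle_cdf nu).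
Proof.
move=> x n ni; rewrite /circle_cdf.
under eq_Rintegral do rewrite count_belowD//.
rewrite RintegralD//; last 2 first.
- exact: integrable_count_below.
- by apply: (@integrable_bounded _ (cst n) `|n|).
congr (_ + _); rewrite (Rintegral_cst _ measurableT) -[RHS]mulr1.
by congr (_ * _); exact: (congr1 fine (probability_setT nu)).
Qed.

(** The integer carry when [F] leaves the fundamental domain. It depends on [u] alone and not on
    [x], so its integral is the constant by which [F] shifts [circle_cdf]. *)
Let j (u : circle R) : R := F (circle_sec u) - circle_sec (circle_map F u).

Let j_int u : j u \is a Num.int.
Proof. by apply/circle_piP; rewrite circle_secK. Qed.

(** [F] preserves order and integer translations, so it carries the inequalities locating [x]
    between consecutive lifts of [u] to those locating [F x] between lifts of the image. *)
Let count_below_map x u :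
  count_below (F x) (circle_map F u) = count_below x u + j u.
Proof.
have /intrP[m jm] := j_int u.
rewrite /count_below.
have -> : circle_sec (circle_map F u) = F (circle_sec u) - m%:~R.
  by rewrite -jm /j; ring.
rewrite jm -intrD; congr (_%:~R); apply: floor_def.
have := floor_itv (x - circle_sec u); set q := Num.floor _ => /andP[l r].
have mono := lift_le_mono Flt.
have l' : F (circle_sec u) + q%:~R <= F x.
  by rewrite -F1 ?intr_int// mono; lra.
have r' : F x < F (circle_sec u) + (q + 1)%:~R.
  by rewrite -F1 ?intr_int// ltNge mono -ltNge; lra.
by move: r'; rewrite !intrD => r'; apply/andP; split; lra.
Qed.

Let mf := continuous_circle_measurable (circle_map_continuous cF F1).

Let mj : measurable_fun [set: circle_borel R] (j : circle_borel R -> R).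
Proof.
apply: measurable_funB; last exact: measurableT_comp measurable_circle_sec mf.
apply: (@measurableT_comp _ _ _ _ _ _ F _ (@circle_sec R : circle_borel R -> R)).
  by apply: nondecreasing_measurable => //; exact: ltW_homo.
exact: measurable_circle_sec.
Qed.

Lemma invariant_Rintegral (nu : probability (circle_borel R) R)
    (f : circle_borel R -> R) (C : R) : Defs.invariant (circle_map F) nu ->
  measurable_fun setT f -> (forall u, `|f u| <= C) ->
  \int[nu]_u f u = \int[nu]_u f (circle_map F u).
Proof.
move=> inu mf' fC; rewrite /Rintegral; congr fine.
have -> : (\int[nu]_u (f u)%:E = \int[pushforward nu (circle_map F :
    circle_borel R -> circle_borel R)]_u (f u)%:E)%E.
  by apply: eq_measure_integral => A mA _; rewrite -[LHS]inu.
rewrite (integral_pushforward mf)//.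
- exact/measurable_EFinP.
- apply: (@integrable_bounded nu (f \o circle_map F) C) => [|u].
    exact: measurableT_comp.
  exact: fC.
Qed.

Lemma circle_cdf_map nu x : Defs.invariant (circle_map F) nu ->
  circle_cdf nu (F x) = circle_cdf nu x + \int[nu]_u j u.
Proof.
move=> inu; rewrite /circle_cdf.
rewrite (invariant_Rintegral inu (measurable_count_below (F x))
  (count_below_norm (F x))).
under eq_Rintegral do rewrite count_below_map.
rewrite RintegralD//; first exact: integrable_count_below.
(* Reading [count_below_map] at 0 shows that [j] is bounded, hence integrable. *)
have jE u : j u = count_below (F 0) (circle_map F u) - count_below 0 u.
  by rewrite count_below_map addrAC subrr add0r.
apply: (@integrable_bounded _ _ (`|F 0| + 2 + (`|0| + 2))) => // u.
by rewrite jE; apply: le_trans (ler_normB _ _) _; apply: lerD; exact: count_below_norm.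
Qed.

(** Here [x - circle_sec u] lies in []-1, 1[], so its floor is -1 when the section exceeds [x] and 0
    otherwise. *)
Lemma circle_cdf_itv (nu : probability (circle_borel R) R) x : 0 <= x < 1 ->
  circle_cdf nu x = - fine (nu ((@circle_sec R) @^-1` `]x, +oo[)).
Proof.
move=> /andP[x0 x1]; set S := _ @^-1` _.
have mS : measurable (S : set (circle_borel R)).
  by rewrite -[X in measurable X]setTI; exact: measurable_circle_sec.
have cS u : count_below x u = (-1) * \1_S u.
  have /andP[s0 s1] := circle_sec_itv u.
  rewrite indicE; have [|] := boolP (u \in S).
    rewrite inE /S/= in_itv/= andbT => xu; rewrite mulr1 -[RHS]mulrN1z.
    by congr (_%:~R); apply: floor_def; apply/andP; split; rewrite /=; lra.
  rewrite notin_setE /S/= in_itv/= andbT => /negP; rewrite -leNgt => ux.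
  rewrite mulr0 -[RHS](mulr0z 1); congr (_%:~R); apply: floor_def.
  by apply/andP; split; rewrite /=; lra.
rewrite /circle_cdf; under eq_Rintegral do rewrite cS.
rewrite RintegralZl//; last first.
  apply: (@integrable_bounded _ _ 1); first exact: measurable_indic.
  by move=> u; rewrite indicE; case: (_ \in _); rewrite ?normr1 ?normr0.
by rewrite mulN1r /Rintegral integral_indic// setIT.
Qed.

Lemma circle_sec_tail0 (nu : probability (circle_borel R) R) :
  (fun n : nat => fine (nu ((@circle_sec R) @^-1` `]1 - n.+1%:R^-1, +oo[)))
    @ \oo --> 0.
Proof.
rewrite -[X in _ --> X]/(fine 0%E); apply: fine_cvg.
have mS x : measurable ((@circle_sec R : circle_borel R -> R) @^-1` `]x, +oo[).
  by rewrite -[X in measurable X]setTI; exact: measurable_circle_sec.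
have cap0 : \bigcap_n ((@circle_sec R : circle_borel R -> R)
    @^-1` `]1 - n.+1%:R^-1, +oo[) = set0.
  apply/seteqP; split => // u H; have /andP[_ s1] := circle_sec_itv u.
  have s0 : 0 < 1 - circle_sec u by rewrite subr_gt0.
  have [k /andP[k1 _]] := @ex_multiple_above R 1 _ ler01 s0.
  have := H k Logic.I; rewrite /= in_itv/= andbT ltrBlDr -ltrBlDl.
  rewrite -div1r ltr_pdivlMr ?ltr0n// -natr1.
  rewrite -(ltrD2l (1 - circle_sec u)) in s0.
  by rewrite mulrDr mulr1 mulrC; lra.
rewrite -[X in _ --> X]/(0%E) -[X in _ --> X](measure0 nu) -cap0.
apply: nonincreasing_cvg_mu.
- exact: le_lt_trans (probability_le1 nu (mS _)) (ltry _).
- by move=> n; exact: mS.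
- by rewrite cap0.
- move=> m n mn; apply/subsetPset => u; rewrite /= !in_itv/= !andbT.
  apply: le_lt_trans; rewrite lerD2l lerN2 lef_pV2 ?posrE ?ltr0n//.
  by rewrite ler_nat ltnS.
Qed.

Lemma invariant_unique (mu nu : probability (circle_borel R) R) :
  Defs.invariant (circle_map F) mu -> Defs.invariant (circle_map F) nu ->
  forall A : set (circle_borel R), measurable A -> nu A = mu A.
Proof.
move=> imu inu.
have trans m : Defs.invariant (circle_map F) m ->
    forall x, circle_cdf m (F x) = circle_cdf m x + rho.
  move=> im x; rewrite circle_cdf_map//; congr (_ + _).
  (* The integral of [j] is forced to be [rho] whatever the invariant measure, so both distribution
     functions solve the same equation. *)
  apply: (semiconj_translation bF (@circle_cdf_nondecreasing m)
    (@circle_cdf_degree1 m)) => y.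
  exact: circle_cdf_map.
have E x : circle_cdf mu x - circle_cdf mu 0 = circle_cdf nu x - circle_cdf nu 0.
  by apply: (@semiconj_unique _ F rho) => //; auto using circle_cdf_nondecreasing,
    circle_cdf_degree1.
pose S x := (@circle_sec R : circle_borel R -> R) @^-1` `]x, +oo[.
have mS x : measurable (S x).
  by rewrite -[X in measurable X]setTI; exact: measurable_circle_sec.
pose d := circle_cdf mu 0 - circle_cdf nu 0.
have Ed x : 0 <= x < 1 -> fine (nu (S x)) - fine (mu (S x)) = d.
  move=> x01; have := E x; rewrite /d.
  by rewrite (circle_cdf_itv mu x01) (circle_cdf_itv nu x01) -/(S x); lra.
(* The tails of both measures differ by the same constant for all [x] in [[0, 1[]; letting [x] tend
   to 1, where the tails vanish, gives 0. *)
have d0 : d = 0.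
  have lim0 := cvgB (circle_sec_tail0 nu) (circle_sec_tail0 mu).
  rewrite subr0 in lim0.
  apply/esym; apply: (cvg_unique _ (lim0 _)) => //.
  rewrite (_ : _ - _ = cst d); first exact: cvg_cst.
  apply/funext => n; apply: Ed; apply/andP; split.
    by rewrite subr_ge0 invf_le1 ?ltr0n// ler1n.
  by rewrite ltrBlDr ltrDl invr_gt0 ltr0n.
have mlt (m : probability (circle_borel R) R) (A : set (circle_borel R)) :
    measurable A -> (m A < +oo)%E.
  by move=> mA; rewrite (le_lt_trans (probability_le1 m mA))// ltry.
have ES x : nu (S x) = mu (S x).
  have [x0|x0] := ltP x 0.
    have -> : S x = setT; last by rewrite !probability_setT.
    apply/seteqP; split => u // _; rewrite /S/= in_itv/= andbT (lt_le_trans x0)//.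
    by case/andP: (circle_sec_itv u).
  have [x1|x1] := leP 1 x.
    have -> : S x = set0; last by rewrite !measure0.
    apply/seteqP; split => u //; rewrite /S/= in_itv/= andbT => xu.
    by have /andP[_] := circle_sec_itv u; lra.
  apply/eqP; rewrite -[X in X == _]fineK ?ge0_fin_numE ?mlt//.
  rewrite -[X in _ == X]fineK ?ge0_fin_numE ?mlt// eqe; apply/eqP.
  by have := Ed x; rewrite x0 x1 d0 => /(_ isT); lra.
move=> A mA.
(* Every Borel set of the circle is a preimage under the section, which moves the comparison to the
   line, where the rays []x, +oo[] form a generating family stable under intersection. *)
have -> : A = (@circle_sec R : circle_borel R -> measurableTypeR R) @^-1`
    ((@circle_pi R : measurableTypeR R -> circle_borel R) @^-1` A).
  by apply/seteqP; split => u /=; rewrite circle_secK.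
set B := _ @^-1` A.
have mB : measurable B.
  by rewrite -[X in measurable X]setTI; exact: measurable_circle_pi.
have ms := measurable_circle_sec.
rewrite -[LHS]/(pushforward nu (@circle_sec R : circle_borel R -> measurableTypeR R) B).
rewrite -[RHS]/(pushforward mu (@circle_sec R : circle_borel R -> measurableTypeR R) B).
apply: (@measure_unique _ R (measurableTypeR R) (@RGenOInfty.G R)
  (fun n => `](- n%:R), +oo[%classic)) => //.
- exact: RGenOInfty.measurableE.
- move=> _ _ [x ->] [y ->]; exists (Num.max x y); apply/seteqP; split => z /=.
    by rewrite !in_itv/= !andbT gt_max => -[-> ->].
  by rewrite !in_itv/= !andbT gt_max => /andP[].
- by move=> n; exists (- n%:R).
- apply/seteqP; split => // z _.
  have [k /andP[k1 _]] := @ex_multiple_above R `|z| _ (normr_ge0 z) ltr01.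
  exists k => //; rewrite /= in_itv/= andbT ltrNl.
  by rewrite (le_lt_trans (ler_norm _))// normrN -[k%:R]mulr1.
- by move=> _ [x ->]; exact: ES.
- by move=> n; exact: (mlt nu _ (mS _)).
Qed.

End invariant_unique.
End circle_measure.

(** * The bi-critical circle map *)

Lemma card_eq_set2 (T : Type) (a b : T) : a <> b -> ([set a; b] #= `I_2)%card.
Proof.
move=> ab; apply/eq_cardSP; exists b; first by right.
rewrite (_ : _ `\ b = [set a]) ?card_set1//.
by apply/seteqP; split => x /= => [[[]]|->]//; split => //; left.
Qed.

Section trig_circle_map.
Context {R : realType}.
Variables (rho t : R).
Hypothesis t01 : 0 < t < 1.

Let F := trig_map rho t.
Let f := circle_map F.

Let t_notint : t \isn't a Num.int.
Proof.
have [t0 t1] := andP t01; apply/negP => ti.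
by apply: (@int_dist_lt1 R 0 t); rewrite ?rpred0//; lra.
Qed.

Let lF : is_lift f F.
Proof.
by apply: is_lift_circle_map; [exact: trig_map_continuous|exact: trig_map_degree1].
Qed.

Lemma circle_marked_neq : circle_pi 0 <> circle_pi t.
Proof. by move/circle_piP; rewrite sub0r rpredN; apply/negP. Qed.

Lemma trig_map_Ck k : Ck_on k setT F.
Proof.
apply: Ck_rec_Ck_on; first exact: openT.
by apply: Ck_recD; [exact: trig_lift_Ck|exact: Ck_rec_cst].
Qed.

Lemma trig_map_crit (x : R) :
  is_derive x 1 F 0 <-> x \is a Num.int \/ x - t \is a Num.int.
Proof.
rewrite -trig_lift_crit; set w := rotation_param (trig_lift t) rho.
split => H.
  have := is_deriveB H (is_derive_cst w x 1); rewrite subr0.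
  rewrite (_ : F - cst w = trig_lift t)//.
  by apply/funext => y; rewrite /F /trig_map -/w; exact: addrK.
by have := is_deriveD H (is_derive_cst w x 1); rewrite addr0.
Qed.

Lemma trig_critical_points :
  critical_point f = [set circle_pi 0; circle_pi t].
Proof.
rewrite (critical_pointE lF); apply/seteqP; split => c /=.
  move=> [x [<- /trig_map_crit[xi|xi]]]; [left|right]; apply/circle_piP => //.
  by rewrite subr0.
move=> [->|->]; [exists 0|exists t]; split => //; apply/trig_map_crit.
  by left; exact: rpred0.
by right; rewrite subrr rpred0.
Qed.

Lemma trig_nonflat c : critical_point f c -> nonflat f c.
Proof.
have [t0 t1] := andP t01.
have key p b : 0 <= b < 1 -> b != 0 ->
    (p = 0 /\ b = 1 - t) \/ (p = t /\ b = t) -> nonflat_at F p 3.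
  move=> b01 b0 /(trig_lift_cube b01 b0)[u [uE Cu u0]].
  apply: (@nonflat_cube R F u) => // y.
  by rewrite /F /trig_map uE addrAC.
rewrite trig_critical_points => -[->|->].
  exists F, 0, 3; split => //; first by lra.
  apply: (@key 0 (1 - t)); last by left.
    by apply/andP; split; lra.
  by apply/eqP; lra.
exists F, t, 3; split => //; first by lra.
apply: (@key t t); last by right.
  by apply/andP; split; lra.
by apply/eqP; lra.
Qed.

Lemma trig_multicritical : multicritical 2 f.
Proof.
split => //.
- by exists F; split => //; exact: trig_map_Ck.
- split; last by exists F; split => //; exact: trig_map_lt.
  apply: circle_map_homeomorphism; [exact: trig_map_lt|exact: trig_map_degree1|].
  exact: trig_map_continuous.
- rewrite trig_critical_points; apply: card_eq_set2; exact: circle_marked_neq.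
- exact: trig_nonflat.
Qed.

(** * Measures of the two arcs *)

Section arcs.
Variables (h : R -> R) (alpha : R) (mu : probability (circle_borel R) R).
Hypotheses (hi : {homo h : x y / x <= y}) (h1 : degree1 h) (ch : continuous h).
Hypotheses (h0 : h 0 = 0) (ht : h t = alpha).
Hypothesis muE : forall A : set (circle_borel R), measurable A ->
  mu A = lebesgue_measure ((@circle_pi R \o quasi_inverse h) @^-1` A `&` `[0, 1[).

(** By monotonicity of [h], the quasi-inverse of a point of []h a, h b[] falls in []a, b[]. *)
Let arc_ge (a b : R) : 0 <= a -> a < b -> b <= 1 ->
  0 <= h a -> h b <= 1 -> h a <= h b ->
  ((h b - h a)%:E <= mu (@circle_pi R @` `]a, b[ : set (circle_borel R)))%E.
Proof.
move=> a0 ab b1 ha hb hab.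
have mA : measurable (@circle_pi R @` `]a, b[ : set (circle_borel R)).
  by apply: sub_sigma_algebra; exact: open_circle_arc.
rewrite muE//.
have [E|lt] := eqVneq (h a) (h b); first by rewrite E subrr measure_ge0.
have lt' : h a < h b by rewrite lt_neqAle lt hab.
have -> : ((h b - h a)%:E = lebesgue_measure `]h a, h b[)%E.
  by rewrite lebesgue_measure_itv/= lte_fin lt' EFinB.
have mk : measurable_fun [set: measurableTypeR R]
    (@circle_pi R \o quasi_inverse h : measurableTypeR R -> circle_borel R).
  apply: measurableT_comp; first exact: measurable_circle_pi.
  apply: nondecreasing_measurable => // x y.
  exact: quasi_inverse_nondecreasing.
apply: le_measure.
- by rewrite inE.
- rewrite inE; apply: measurableI => //.
  by rewrite -[X in measurable X]setTI; exact: mk.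
move=> y; rewrite /= in_itv/= => /andP[ya yb]; split; last first.
  by rewrite /= in_itv/=; apply/andP; split; lra.
have K := quasi_inverseK hi h1 ch y.
exists (quasi_inverse h y) => //; rewrite /= in_itv/=; apply/andP; split.
  by rewrite ltNge; apply/negP => /hi; rewrite K; lra.
by rewrite ltNge; apply/negP => /hi; rewrite K; lra.
Qed.

(** The two lower bounds add up to 1, while the disjoint arcs have total mass at most 1; both bounds
    are therefore equalities, and no separate study of the mass of the critical points arises. *)
Lemma mu_arcs : 0 < alpha < 1 ->
  mu (@circle_pi R @` `]0, t[) = alpha%:E /\
  mu (@circle_pi R @` `]t, 1[) = (1 - alpha)%:E.
Proof.
move=> /andP[a0 a1]; have [t0 t1] := andP t01.
have h11 : h 1 = 1 by rewrite -[X in h X]add0r h1 ?rpred1// h0 add0r.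
pose arc (a b : R) : set (circle_borel R) := @circle_pi R @` `]a, b[.
have mA a b : measurable (arc a b).
  by apply: sub_sigma_algebra; exact: open_circle_arc.
have A1 : (alpha%:E <= mu (arc 0%R t))%E.
  by have := @arc_ge 0 t; rewrite h0 ht subr0; apply; lra.
have B1 : ((1 - alpha)%:E <= mu (arc t 1%R))%E.
  by have := @arc_ge t 1; rewrite h11 ht; apply; lra.
have AB : (mu (arc 0%R t) + mu (arc t 1%R) <= 1)%E.
  rewrite -measureU//; first by apply: probability_le1; exact: measurableU.
  exact: circle_arcs_disjoint.
rewrite -/(arc 0 t) -/(arc t 1); move: A1 B1 AB.
have fin a b : mu (arc a b) \is a fin_num by exact: fin_num_measure.
rewrite -(fineK (fin 0 t)) -(fineK (fin t 1)) -EFinD !lee_fin => A1 B1 AB.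
by split; congr (_%:E); lra.
Qed.

End arcs.
End trig_circle_map.

Unset Implicit Arguments.

Theorem mainTheorem5 (R : realType) (rho alpha : R)
    (rho_itv : rho \in `[0, 1]) (rho_irr : irrational rho)
    (alpha_itv : alpha \in `]0, 1[) :
  exists (f : circle R -> circle R) (mu : probability (circle_borel R) R)
         (c1 c2 : circle R),
    [/\ circle_smooth f, multicritical 2 f, has_rotation_number f rho,
        unique_invariant f mu
      & [/\ c1 <> c2, critical_point f = [set c1; c2]
          & exists A B : set (circle R),
              [/\ A <> B, components (~` [set c1; c2]) = [set A; B],
                  mu A = alpha%:E & mu B = (1 - alpha)%:E]]].
Proof.
have r01 : 0 <= rho <= 1 by move: rho_itv; rewrite in_itv.
have a01 : 0 < alpha < 1 by move: alpha_itv; rewrite in_itv.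
have [t [t01 ht]] := ex_marked_eq rho_irr a01.
pose F := trig_map rho t.
have Flt : {homo F : x y / x < y} by exact: trig_map_lt.
have Fle : {homo F : x y / x <= y} by exact: trig_map_le.
have F1 : degree1 F by exact: trig_map_degree1.
have cF : continuous F by exact: trig_map_continuous.
have bF : bounded_displacement F rho by exact: bounded_displacement_trig_map.
(* Normalized to vanish at 0, so that [h t] is [alpha] itself and [h 1] is 1. *)
pose h x := semiconj F rho x - semiconj F rho 0.
have hi : {homo h : x y / x <= y}.
  by move=> x y xy; rewrite lerD2r; exact: semiconj_nondecreasing.
have h1 : degree1 h.
  by move=> x n ni; rewrite /h (semiconj_degree1 F1 bF)// addrAC.
have hF x : h (F x) = h x + rho by rewrite /h (semiconj_eq bF) addrAC.
have ch : continuous h by exact: semiconj_continuous hF.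
have lF : is_lift (circle_map F) F by exact: is_lift_circle_map.
have [mu [imu muE]] := ex_invariant_measure Flt F1 cF hi h1 ch hF r01.
have h0 : h 0 = 0 by rewrite /h subrr.
have [muA muB] := mu_arcs t01 hi h1 ch h0 ht muE a01.
exists (circle_map F), mu, (circle_pi 0), (circle_pi t); split.
- by move=> k; exists F; split => //; exact: trig_map_Ck.
- exact: trig_multicritical.
- by exists F; split => // x; exact: bounded_displacement_cvg.
- by split => // nu inu A mA; exact: (invariant_unique Flt F1 cF bF rho_irr).
split; [exact: circle_marked_neq|exact: trig_critical_points|].
exists (@circle_pi R @` `]0, t[), (@circle_pi R @` `]t, 1[); split => //.
  have [t0 t1] := andP t01; have := circle_arcs_disjoint t01 => + E.
  rewrite -E setIid => /seteqP[/(_ (circle_pi (t / 2)))+ _]; apply.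
  by exists (t / 2) => //; rewrite /= in_itv/=; apply/andP; split; lra.
exact: components_circle_arcs.
Qed.
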